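(* Let $\tau$ be a topology on $\mathbb{R}$ such that (i) $\tau_e\subset\tau$, and (ii) every nonempty $\tau$-open set has the Baire property and is non-meager (with respect to the Euclidean topology). Then the class of pointwise limits of sequences of $\tau$-Świątkowski functions equals $\mathfrak{S}$.
   Context: $\tau_e$ is the Euclidean topology on $\mathbb{R}$. For a topology $\tau$ and $f\colon\mathbb{R}\to\mathbb{R}$, $\mathrm{C}_\tau(f)$ is the set of points at which $f\colon(\mathbb{R},\tau)\to(\mathbb{R},\tau_e)$ is continuous. $f$ is a $\tau$-Świątkowski function if for all $a,b\in\mathbb{R}$ with $f(a)<f(b)$ there exists $x\in\mathrm{C}_\tau(f)$ strictly between $a$ and $b$ with $f(a)<f(x)<f(b)$. A function has the Baire property if preimages of open sets are of the form $O\triangle M$ with $O$ open and $M$ meager; a set is residual if its complement is meager. For $a,b\in\mathbb{R}$, $I(a,b)$ is the open interval with end-points $a,b$. For $A\subset\mathbb{R}$, an interval $J$ and $\varepsilon\ge0$, $f$ satisfies $S(J,A,\varepsilon)$ if for all $a,b\in J$ with $f(a)<f(b)$ there exists $x\in A\cap I(a,b)$ with $f(x)\in(f(a)-\varepsilon,f(b)+\varepsilon)$. $f$ satisfies $S(A,\varepsilon)$ if the union of all open intervals $J$ for which $S(J,A,\varepsilon)$ holds is dense in $\mathbb{R}$. $\mathfrak{S}$ is the class of functions with the Baire property satisfying $S(A,\varepsilon)$ for all residual $A\subset\mathbb{R}$ and all $\varepsilon>0$. *)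

(* Defs.v *)
From Stdlib Require Import Reals Classical.
Open Scope R_scope.

Definition is_topology (tau : (R -> Prop) -> Prop) : Prop :=
  tau (fun _ => True) /\ tau (fun _ => False) /\
  (forall U V, tau U -> tau V -> tau (fun x => U x /\ V x)) /\
  (forall F : (R -> Prop) -> Prop,
      (forall U, F U -> tau U) -> tau (fun x => exists U, F U /\ U x)).

Definition nowhere_dense (A : R -> Prop) : Prop :=
  forall x, ~ interior (adherence A) x.

Definition meager (A : R -> Prop) : Prop :=
  exists N : nat -> R -> Prop,
    (forall n, nowhere_dense (N n)) /\ (forall x, A x -> exists n, N n x).

Definition residual (A : R -> Prop) : Prop := meager (fun x => ~ A x).

Definition baire_set (A : R -> Prop) : Prop :=
  exists O M, open_set O /\ meager M /\
    forall x, A x <-> ((O x /\ ~ M x) \/ (~ O x /\ M x)).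

Definition baire_fun (f : R -> R) : Prop :=
  forall U, open_set U -> baire_set (fun x => U (f x)).

Definition cont_tau (tau : (R -> Prop) -> Prop) (f : R -> R) (x : R) : Prop :=
  forall eps, eps > 0 ->
    exists U, tau U /\ U x /\ forall y, U y -> Rabs (f y - f x) < eps.

Definition in_I (a b x : R) : Prop := Rmin a b < x < Rmax a b.

Definition swiatkowski (tau : (R -> Prop) -> Prop) (f : R -> R) : Prop :=
  forall a b, f a < f b ->
    exists x, cont_tau tau f x /\ in_I a b x /\ f a < f x < f b.

Definition S_J (f : R -> R) (c d : R) (A : R -> Prop) (eps : R) : Prop :=
  forall a b, c < a < d -> c < b < d -> f a < f b ->
    exists x, A x /\ in_I a b x /\ f a - eps < f x < f b + eps.

(* S(A,eps): the union of the open intervals J with S(J,A,eps) is dense,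
   i.e. it meets every nonempty open interval (p,q). *)
Definition S_A (f : R -> R) (A : R -> Prop) (eps : R) : Prop :=
  forall p q, p < q ->
    exists c d x, c < d /\ S_J f c d A eps /\ c < x < d /\ p < x < q.

Definition frakS (f : R -> R) : Prop :=
  baire_fun f /\ forall A, residual A -> forall eps, eps > 0 -> S_A f A eps.

Definition lim_swiat (tau : (R -> Prop) -> Prop) (f : R -> R) : Prop :=
  exists fn : nat -> R -> R,
    (forall n, swiatkowski tau (fn n)) /\
    forall x, Un_cv (fun n => fn n x) (f x).

(* Main.v *)
Require Import Defs.
From Stdlib Require Import Reals Classical.
From Stdlib Require Import ClassicalEpsilon Lra Lia Cantor.
Open Scope R_scope.

(** A set open for [tau] agrees with a Euclidean open set up to a meager set, so a dense
[tau]-open set is residual.  Hence a [tau]-Świątkowski function is [tau]-continuous on a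
residual set and has the Baire property, and along a convergent sequence of such functions
the category argument gives intervals on which the convergence is uniform up to [eta] on a
residual set; there the Świątkowski condition passes to the limit as [S_J].

Conversely, let [f] in [frakS] be continuous relative to a residual set [B].  For increasing
closed nowhere dense sets [F n], whose union has a dense complement contained in [B], let the
n-th function agree with [f] on [F n] and, on each component (u, v) of the complement, be
continuous and oscillate near both ends over an open interval slightly larger than the range
of [f] on [B] in (u, v).  The size of the enlargement is dictated by how well the condition
[tame] below holds near (u, v): it tends to 0 outside the union of the [F n], yet it is large
enough for a connectedness argument to produce intermediate values between any two points
of [F n]. *)

(** * Baire category on the line *)

(** The strict inequalities leave room on both sides, so that the limit point of the nested
    intervals in [baire_category] lies inside all of them. *)
Definition nowhere_dense_in_intervals (A : R -> Prop) : Prop :=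
  forall p q, p < q ->
    exists p' q', p < p' /\ p' < q' /\ q' < q /\ forall x, p' < x < q' -> ~ A x.

Lemma open_set_intervals (D : R -> Prop) :
  open_set D <->
  forall x, D x -> exists c d, c < x < d /\ forall y, c < y < d -> D y.
Proof.
split.
- intros H x Dx. destruct (H x Dx) as [[e He] Hd].
  exists (x - e), (x + e); split; [lra|].
  intros y Hy; apply Hd; unfold disc; simpl.
  apply Rabs_def1; lra.
- intros H x Dx. destruct (H x Dx) as (c & d & Hx & Hd).
  assert (He : 0 < Rmin (x - c) (d - x)) by (apply Rmin_pos; lra).
  exists (mkposreal _ He). intros y Hy; unfold disc in Hy; simpl in Hy.
  pose proof (Rmin_l (x - c) (d - x)); pose proof (Rmin_r (x - c) (d - x)).
  apply Rabs_def2 in Hy. apply Hd; lra.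
Qed.

Lemma open_set_interval (c d : R) : open_set (fun x => c < x < d).
Proof. apply open_set_intervals. intros x Hx; exists c, d; auto. Qed.

Lemma nowhere_dense_intervals (A : R -> Prop) :
  nowhere_dense A <-> nowhere_dense_in_intervals A.
Proof.
split.
- intros H p q Hpq.
  assert (He : 0 < (q - p) / 2) by lra.
  destruct (classic (forall y, p < y < q -> adherence A y)) as [Hall|Hn].
  + exfalso. apply (H ((p + q) / 2)). exists (mkposreal _ He).
    intros y Hy; unfold disc in Hy; simpl in Hy. apply Rabs_def2 in Hy.
    apply Hall; lra.
  + apply not_all_ex_not in Hn as [y Hy]. apply imply_to_and in Hy as [Hy Hn].
    unfold adherence, point_adherent in Hn.
    apply not_all_ex_not in Hn as [V HV]. apply imply_to_and in HV as [[[e He'] HV] Hn].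
    set (p' := Rmax (y - e) ((p + y) / 2)). set (q' := Rmin (y + e) ((y + q) / 2)).
    assert (y - e <= p' /\ (p + y) / 2 <= p' /\ p' < y).
    { unfold p'; split; [apply Rmax_l|split; [apply Rmax_r|apply Rmax_lub_lt; lra]]. }
    assert (q' <= y + e /\ q' <= (y + q) / 2 /\ y < q').
    { unfold q'; split; [apply Rmin_l|split; [apply Rmin_r|apply Rmin_glb_lt; lra]]. }
    exists p', q'. repeat split; try lra.
    intros x Hx Ax. apply Hn. exists x; split; auto.
    apply HV. unfold disc; simpl. apply Rabs_def1; lra.
- intros H x [[e He] Hd].
  destruct (H (x - e) (x + e)) as (p & q & H1 & H2 & H3 & H4); [lra|].
  assert (Ha : adherence A ((p + q) / 2)).
  { apply Hd; unfold disc; simpl; apply Rabs_def1; lra. }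
  destruct (Ha (fun y => p < y < q)) as [y [Hy Ay]].
  + apply (open_set_interval p q); lra.
  + exact (H4 y Hy Ay).
Qed.

Lemma meager_sub (A B : R -> Prop) :
  (forall x, A x -> B x) -> meager B -> meager A.
Proof. intros H (N & H1 & H2). exists N; auto. Qed.

Lemma nowhere_dense_meager (A : R -> Prop) :
  nowhere_dense_in_intervals A -> meager A.
Proof.
intros H. exists (fun _ => A); split; [intros _; now apply nowhere_dense_intervals|].
intros x Ax; exists 0%nat; auto.
Qed.

Lemma meager_empty (A : R -> Prop) : (forall x, ~ A x) -> meager A.
Proof.
intros H; apply nowhere_dense_meager. intros p q Hpq.
exists ((2 * p + q) / 3), ((p + 2 * q) / 3). repeat split; try lra. auto.
Qed.

Lemma meager_countable_union (A : nat -> R -> Prop) :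
  (forall n, meager (A n)) -> meager (fun x => exists n, A n x).
Proof.
intros H.
pose (N := fun n => proj1_sig (constructive_indefinite_description _ (H n))).
assert (HN : forall n, (forall m, nowhere_dense (N n m)) /\
    forall x, A n x -> exists m, N n m x).
{ intros n; unfold N; destruct (constructive_indefinite_description _ (H n)); auto. }
exists (fun i => N (fst (of_nat i)) (snd (of_nat i))); split.
- intros i; apply HN.
- intros x [n Ax]. apply HN in Ax as [m Hm].
  exists (to_nat (n, m)). now rewrite cancel_of_to.
Qed.

Lemma meager_or (A B : R -> Prop) :
  meager A -> meager B -> meager (fun x => A x \/ B x).
Proof.
intros HA HB.
apply (meager_sub _ (fun x => exists n, match n with O => A | _ => B end x)).
- intros x [Ax|Bx]; [exists 0%nat|exists 1%nat]; auto.
- apply (meager_countable_union (fun n => match n with O => A | _ => B end)).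
  intros [|n]; auto.
Qed.

Lemma residual_and (A B : R -> Prop) :
  residual A -> residual B -> residual (fun x => A x /\ B x).
Proof.
intros HA HB. apply (meager_sub _ (fun x => ~ A x \/ ~ B x)).
- intros x H; apply not_and_or; auto.
- now apply meager_or.
Qed.

Lemma residual_countable_inter (A : nat -> R -> Prop) :
  (forall n, residual (A n)) -> residual (fun x => forall n, A n x).
Proof.
intros HA. apply (meager_sub _ (fun x => exists n, ~ A n x)).
- intros x H; now apply not_all_ex_not.
- now apply (meager_countable_union (fun n x => ~ A n x)).
Qed.

(** Nested intervals: the interval of index n + 1 avoids [N n], and the supremum of the left
    end-points lies in all of them. *)
Lemma baire_category (A : R -> Prop) (p q : R) :
  meager A -> p < q -> exists x, p < x < q /\ ~ A x.
Proof.
intros (N & HN & HA) Hpq.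
(* Each interval carries a proof that it is nonempty, so that the choice can be iterated. *)
assert (Hstep : forall (n : nat) (I : {I : R * R | fst I < snd I}),
  exists J : {J : R * R | fst J < snd J},
    fst (proj1_sig I) < fst (proj1_sig J) /\ snd (proj1_sig J) < snd (proj1_sig I) /\
    forall x, fst (proj1_sig J) < x < snd (proj1_sig J) -> ~ N n x).
{ intros n [[a b] Hab]; simpl in *.
  destruct (proj1 (nowhere_dense_intervals _) (HN n) a b Hab) as (a' & b' & H1 & H2 & H3 & H4).
  exists (exist (fun J => fst J < snd J) (a', b') H2); simpl; auto. }
pose (next := fun n I => proj1_sig (constructive_indefinite_description _ (Hstep n I))).
assert (Hnext : forall n I,
    fst (proj1_sig I) < fst (proj1_sig (next n I)) /\
    snd (proj1_sig (next n I)) < snd (proj1_sig I) /\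
    forall x, fst (proj1_sig (next n I)) < x < snd (proj1_sig (next n I)) -> ~ N n x).
{ intros n I; unfold next; destruct (constructive_indefinite_description _ (Hstep n I)); auto. }
pose (I := fix I n := match n with
  | O => exist (fun J : R * R => fst J < snd J) (p, q) Hpq
  | S m => next m (I m) end).
pose (l := fun n => fst (proj1_sig (I n))). pose (r := fun n => snd (proj1_sig (I n))).
assert (Hl : forall n, l n < l (S n)) by (intros n; apply (Hnext n (I n))).
assert (Hr : forall n, r (S n) < r n) by (intros n; apply (Hnext n (I n))).
assert (Hlr : forall n, l n < r n) by (intros n; apply (proj2_sig (I n))).
assert (HlM : forall n m, (n <= m)%nat -> l n <= l m).
{ intros n m Hm; induction Hm; [lra|]. specialize (Hl m); lra. }
assert (HrM : forall n m, (n <= m)%nat -> r m <= r n).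
{ intros n m Hm; induction Hm; [lra|]. specialize (Hr m); lra. }
assert (Hcross : forall n m, l n < r m).
{ intros n m. specialize (HlM n (max n m) ltac:(lia)). specialize (HrM m (max n m) ltac:(lia)).
  specialize (Hlr (max n m)); lra. }
destruct (completeness (fun y => exists n, y = l n)) as [s [Hub Hlub]].
- exists (r 0%nat). intros y [n ->]. specialize (Hcross n 0%nat); lra.
- exists (l 0%nat); eauto.
- assert (Hin : forall n, l n < s < r n).
  { intros n; split.
    - specialize (Hl n). assert (l (S n) <= s) by (apply Hub; eauto). lra.
    - specialize (Hr n). assert (s <= r (S n)).
      { apply Hlub. intros y [m ->]. specialize (Hcross m (S n)); lra. }
      lra. }
  exists s; split; [apply (Hin 0%nat)|].
  intros As. destruct (HA s As) as [n Hn].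
  exact (proj2 (proj2 (Hnext n (I n))) s (Hin (S n)) Hn).
Qed.

(** * Sets with the Baire property *)

(** The meager set of the definition is necessarily the symmetric difference of [A] and [O], so [O]
    alone is kept as witness. *)
Lemma baire_set_mod_meager (A : R -> Prop) :
  baire_set A <-> exists O, open_set O /\ meager (fun x => ~ (A x <-> O x)).
Proof.
split.
- intros (O & M & HO & HM & H). exists O; split; auto.
  apply (meager_sub _ M); auto. intros x Hx. specialize (H x). tauto.
- intros (O & HO & HM). exists O, (fun x => ~ (A x <-> O x)).
  repeat split; auto; intros; tauto.
Qed.

Lemma baire_set_ext_residual (A B C : R -> Prop) :
  residual C -> (forall x, C x -> (A x <-> B x)) -> baire_set B -> baire_set A.
Proof.
intros HC HAB HB. apply baire_set_mod_meager in HB as (O & HO & HM).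
apply baire_set_mod_meager. exists O; split; auto.
apply (meager_sub _ (fun x => ~ C x \/ ~ (B x <-> O x))).
- intros x Hx. specialize (HAB x). tauto.
- now apply meager_or.
Qed.

Lemma baire_set_ext (A B : R -> Prop) :
  (forall x, A x <-> B x) -> baire_set B -> baire_set A.
Proof.
intros H. apply (baire_set_ext_residual _ _ (fun _ => True)); auto.
apply meager_empty; auto.
Qed.

Lemma open_baire_set (A : R -> Prop) : open_set A -> baire_set A.
Proof.
intros HA. apply baire_set_mod_meager. exists A; split; auto.
apply meager_empty; tauto.
Qed.

Lemma open_exterior (O : R -> Prop) :
  open_set (fun x => exists c d, c < x < d /\ forall y, c < y < d -> ~ O y).
Proof.
apply open_set_intervals. intros x (c & d & Hx & H). exists c, d; split; eauto.
Qed.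

(** The complement of [O] and its exterior [E] differ by the boundary of [O], which is nowhere
    dense. *)
Lemma baire_set_compl (A : R -> Prop) : baire_set A -> baire_set (fun x => ~ A x).
Proof.
intros HA. apply baire_set_mod_meager in HA as (O & HO & HM).
apply baire_set_mod_meager.
set (E := fun x => exists c d, c < x < d /\ forall y, c < y < d -> ~ O y).
exists E; split; [apply open_exterior|].
apply (meager_sub _ (fun x => ~ (A x <-> O x) \/ ~ (O x \/ E x))).
- intros x Hx. apply NNPP; intros Hn. apply Hx.
  assert (E x -> ~ O x) by (intros (c & d & Hcd & H); auto). tauto.
- apply meager_or; auto. apply nowhere_dense_meager. intros p q Hpq.
  destruct (classic (exists x, p < x < q /\ O x)) as [(x & Hx & Ox)|Hn].
  + destruct (proj1 (open_set_intervals _) HO x Ox) as (c & d & Hcd & H).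
    exists (Rmax c ((p + x) / 2)), (Rmin d ((x + q) / 2)).
    pose proof (Rmax_l c ((p + x) / 2)). pose proof (Rmax_r c ((p + x) / 2)).
    pose proof (Rmin_l d ((x + q) / 2)). pose proof (Rmin_r d ((x + q) / 2)).
    assert (Rmax c ((p + x) / 2) < x) by (apply Rmax_lub_lt; lra).
    assert (x < Rmin d ((x + q) / 2)) by (apply Rmin_glb_lt; lra).
    repeat split; try lra.
    intros y Hy Hno; apply Hno; left; apply H; lra.
  + exists ((2 * p + q) / 3), ((p + 2 * q) / 3). repeat split; try lra.
    intros y Hy Hno; apply Hno; right. exists p, q; split; [lra|].
    intros z Hz Oz; apply Hn; eauto.
Qed.

Lemma baire_set_countable_union (A : nat -> R -> Prop) :
  (forall n, baire_set (A n)) -> baire_set (fun x => exists n, A n x).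
Proof.
intros H.
assert (H' : forall n, exists O, open_set O /\ meager (fun x => ~ (A n x <-> O x)))
  by (intros n; now apply baire_set_mod_meager).
pose (O := fun n => proj1_sig (constructive_indefinite_description _ (H' n))).
assert (HO : forall n, open_set (O n) /\ meager (fun x => ~ (A n x <-> O n x))).
{ intros n; unfold O; destruct (constructive_indefinite_description _ (H' n)); auto. }
apply baire_set_mod_meager. exists (fun x => exists n, O n x); split.
- apply open_set_intervals. intros x [n Ox].
  destruct (proj1 (open_set_intervals _) (proj1 (HO n)) x Ox) as (c & d & Hcd & Hd).
  exists c, d; split; eauto.
- apply (meager_sub _ (fun x => exists n, ~ (A n x <-> O n x))).
  + intros x Hx. apply NNPP; intros Hn.
    assert (Hiff : forall n, A n x <-> O n x).
    { intros n; apply NNPP; intros Hc; apply Hn; eauto. }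
    apply Hx; split; intros [n Hnx]; exists n; apply Hiff; auto.
  + apply (meager_countable_union (fun n x => ~ (A n x <-> O n x))); apply HO.
Qed.

Lemma baire_set_countable_inter (A : nat -> R -> Prop) :
  (forall n, baire_set (A n)) -> baire_set (fun x => forall n, A n x).
Proof.
intros H. apply (baire_set_ext _ (fun x => ~ exists n, ~ A n x)).
- intros x; split.
  + intros Hx [n Hn]; auto.
  + intros Hx n; apply NNPP; eauto.
- apply baire_set_compl, (baire_set_countable_union (fun n x => ~ A n x)).
  intros n; now apply baire_set_compl.
Qed.

(** * Limits of Świątkowski functions *)

Definition category_topology (tau : (R -> Prop) -> Prop) : Prop :=
  is_topology tau /\ (forall U, open_set U -> tau U) /\
  (forall U, tau U -> (exists x, U x) -> baire_set U /\ ~ meager U).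

Lemma inv_succ_small (eps : R) :
  eps > 0 -> exists n : nat, forall m, (n <= m)%nat -> 0 < / (INR m + 1) < eps.
Proof.
intros He. destruct (archimed_cor1 eps He) as (n & Hn & Hn0).
exists n; intros m Hm. pose proof (lt_0_INR n Hn0). pose proof (le_INR n m Hm).
assert (/ (INR m + 1) < / INR n) by (apply Rinv_lt_contravar; [nra|lra]).
split; [apply Rinv_0_lt_compat|]; lra.
Qed.

Lemma inv_succ_pos (n : nat) : 0 < / (INR n + 1).
Proof. apply Rinv_0_lt_compat. pose proof (pos_INR n); lra. Qed.

Lemma baire_fun_limit (g : nat -> R -> R) (f : R -> R) :
  (forall n, baire_fun (g n)) -> (forall x, Un_cv (fun n => g n x) (f x)) ->
  baire_fun f.
Proof.
intros Hg Hlim U HU.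
(* [core m] is the closed set of points whose open neighbourhood of radius 1/(m+1) lies in [U];
   [U (f x)] holds exactly when, for some [m], almost all [g n x] lie in [core m]. *)
pose (core := fun m y => forall z, Rabs (z - y) < / (INR m + 1) -> U z).
assert (Hcore : forall m n, baire_set (fun x => core m (g n x))).
{ intros m n. apply (baire_set_ext _ (fun x => ~ ~ core m (g n x))).
{ intros x; split; [auto|apply NNPP]. }
  apply baire_set_compl. apply (Hg n (fun y => ~ core m y)).
  apply open_set_intervals. intros y Hy.
  apply not_all_ex_not in Hy as [z Hz]. apply imply_to_and in Hz as [Hz Uz].
  exists (z - / (INR m + 1)), (z + / (INR m + 1)). split.
  - apply Rabs_def2 in Hz; lra.
  - intros w Hw Hc. apply Uz, Hc, Rabs_def1; lra. }
apply (baire_set_ext _ (fun x => exists m N, forall i, core m (g (N + i)%nat x))).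
- intros x; split.
  + intros Ux. destruct (proj1 (open_set_intervals U) HU _ Ux) as (c & d & Hx & Hd).
    destruct (inv_succ_small (Rmin (f x - c) (d - f x) / 2)) as [m Hm].
    { pose proof (Rmin_pos (f x - c) (d - f x)); lra. }
    destruct (Hm m (le_n m)) as [Hm0 Hm1].
    pose proof (Rmin_l (f x - c) (d - f x)). pose proof (Rmin_r (f x - c) (d - f x)).
    destruct (Hlim x _ Hm0) as [N HN].
    exists m, N; intros i z Hz. specialize (HN (N + i)%nat ltac:(lia)).
    unfold Rdist in HN. apply Rabs_def2 in Hz, HN. apply Hd; lra.
  + intros (m & N & HN). destruct (Hlim x _ (inv_succ_pos m)) as [M HM].
    specialize (HM (N + M)%nat ltac:(lia)). unfold Rdist in HM.
    apply (HN M). now rewrite Rabs_minus_sym.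
- apply (baire_set_countable_union (fun m x => exists N, forall i, core m (g (N + i)%nat x))).
  intros m. apply (baire_set_countable_union (fun N x => forall i, core m (g (N + i)%nat x))).
  intros N. apply (baire_set_countable_inter (fun i x => core m (g (N + i)%nat x))).
  intros i; apply Hcore.
Qed.

(** Written as the union of a family, in the shape of the last clause of [is_topology]. *)
Definition tau_interior (tau : (R -> Prop) -> Prop) (A : R -> Prop) (x : R) : Prop :=
  exists U, (tau U /\ forall y, U y -> A y) /\ U x.

Lemma tau_interior_open tau (A : R -> Prop) : is_topology tau -> tau (tau_interior tau A).
Proof. intros (_ & _ & _ & H). apply H. tauto. Qed.

Lemma tau_open_baire_set tau (V : R -> Prop) :
  category_topology tau -> tau V -> baire_set V.
Proof.
intros (_ & _ & H) HV. destruct (classic (exists x, V x)) as [Hx|Hn].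
- now apply H.
- apply (baire_set_ext _ (fun _ => False)).
  + intros x; split; [eauto|tauto].
  + apply open_baire_set. intros x [].
Qed.

Lemma tau_open_meets_residual tau (V A : R -> Prop) :
  category_topology tau -> tau V -> residual A -> (exists x, V x) ->
  exists y, V y /\ A y.
Proof.
intros (_ & _ & H) HV HA Hx. apply NNPP; intros Hn.
apply (H V HV Hx). apply (meager_sub _ (fun x => ~ A x)); auto.
intros x Vx Ax; eauto.
Qed.

Lemma open_shrink (D : R -> Prop) (p q : R) :
  open_set D -> (exists x, D x /\ p < x < q) ->
  exists p' q', p < p' /\ p' < q' /\ q' < q /\ forall x, p' < x < q' -> D x.
Proof.
intros HD (x & Dx & Hx).
destruct (proj1 (open_set_intervals D) HD x Dx) as (c & d & Hcd & H).
exists (Rmax c ((p + x) / 2)), (Rmin d ((x + q) / 2)).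
pose proof (Rmax_l c ((p + x) / 2)). pose proof (Rmax_r c ((p + x) / 2)).
pose proof (Rmin_l d ((x + q) / 2)). pose proof (Rmin_r d ((x + q) / 2)).
assert (Rmax c ((p + x) / 2) < x) by (apply Rmax_lub_lt; lra).
assert (x < Rmin d ((x + q) / 2)) by (apply Rmin_glb_lt; lra).
repeat split; try lra. intros y Hy; apply H; lra.
Qed.

Lemma tau_and_interval tau (V : R -> Prop) (p q : R) :
  category_topology tau -> tau V -> tau (fun x => V x /\ p < x < q).
Proof.
intros ((_ & _ & Hi & _) & Ho & _) HV. apply (Hi V (fun x => p < x < q)); auto.
apply Ho, open_set_interval.
Qed.

(* A tau-open set is a Euclidean open set up to a meager one; if the open set missed
   an interval, a nonempty tau-open subset of that interval would be meager. *)
Lemma tau_open_dense_residual_in tau (V P : R -> Prop) :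
  category_topology tau -> tau V -> open_set P ->
  (forall p q, p < q -> (forall x, p < x < q -> P x) -> exists x, V x /\ p < x < q) ->
  meager (fun x => P x /\ ~ V x).
Proof.
intros Ht HV HP Hd.
pose proof (tau_open_baire_set tau V Ht HV) as HB.
apply baire_set_mod_meager in HB as (O & HO & HM).
apply (meager_sub _ (fun x => ~ (V x <-> O x) \/ (P x /\ ~ O x))); [intros; tauto|].
apply meager_or; auto. apply nowhere_dense_meager. intros p q Hpq.
destruct (classic (exists x, P x /\ p < x < q)) as [HPx|Hn].
- destruct (open_shrink P p q HP HPx) as (p1 & q1 & H1 & H2 & H3 & H4).
  destruct (open_shrink O p1 q1 HO) as (p' & q' & H1' & H2' & H3' & H4').
  + destruct (tau_open_meets_residual tau (fun x => V x /\ p1 < x < q1)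
      (fun x => V x <-> O x)) as (y & (Vy & Hy) & Hiff); auto.
    * now apply tau_and_interval.
    * exists y; tauto.
  + exists p', q'; repeat split; try lra. intros x Hx' [_ Hno]; auto.
- exists ((2 * p + q) / 3), ((p + 2 * q) / 3). repeat split; try lra.
  intros x Hx [Px _]; apply Hn; exists x; split; auto; lra.
Qed.

(** Without continuity points in (p, q) the Świątkowski condition forces [g] to be constant there,
    hence continuous after all. *)
Lemma swiatkowski_cont_dense tau (g : R -> R) (p q : R) :
  category_topology tau -> swiatkowski tau g -> p < q ->
  exists x, cont_tau tau g x /\ p < x < q.
Proof.
intros (Ht & Ho & _) Hg Hpq. apply NNPP; intros Hn.
assert (Hno : forall a b, p < a < q -> p < b < q -> g a < g b -> False).
{ intros a b Ha Hb Hab. destruct (Hg a b Hab) as (x & Hx & [Hx1 Hx2] & _).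
  apply Hn. exists x; split; auto.
  pose proof (Rmin_glb_lt a b p). pose proof (Rmax_lub_lt a b q). lra. }
apply Hn. exists ((p + q) / 2); split; [|lra].
intros eps He. exists (fun x => p < x < q). repeat split; try lra.
- apply Ho, open_set_interval.
- intros y Hy. destruct (Rtotal_order (g y) (g ((p + q) / 2))) as [H|[H|H]].
  + exfalso; apply (Hno y ((p + q) / 2)); auto; lra.
  + rewrite H, Rminus_diag, Rabs_R0; auto.
  + exfalso; apply (Hno ((p + q) / 2) y); auto; lra.
Qed.

Lemma swiatkowski_cont_residual tau (g : R -> R) :
  category_topology tau -> swiatkowski tau g -> residual (cont_tau tau g).
Proof.
intros Ht Hg.
(* [V n] is the union of the [tau]-open sets on which [g] oscillates by less than 1/(n+1); it is
   dense by the previous lemma, hence residual, and the intersection of all [V n] consists of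
   continuity points. *)
pose (V := fun (n : nat) x => exists U, (tau U /\
  forall y z, U y -> U z -> Rabs (g y - g z) < / (INR n + 1)) /\ U x).
apply (meager_sub _ (fun x => exists n, ~ V n x)).
- intros x Hx. apply not_all_ex_not; intros Hall. apply Hx.
  intros eps He. destruct (inv_succ_small eps He) as [n Hn].
  destruct (Hall n) as (U & [HU Hosc] & Ux).
  exists U; repeat split; auto. intros y Uy.
  specialize (Hn n (le_n n)). specialize (Hosc y x Uy Ux). lra.
- apply (meager_countable_union (fun n x => ~ V n x)); intros n.
  apply (meager_sub _ (fun x => True /\ ~ V n x)); [tauto|].
  apply (tau_open_dense_residual_in tau); auto.
  + destruct Ht as [(_ & _ & _ & Hu) _]. apply Hu; tauto.
  + apply open_set_intervals. intros x _; exists (x - 1), (x + 1); split; [lra|auto].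
  + intros p q Hpq _.
    destruct (swiatkowski_cont_dense tau g p q) as (x & Hx & Hpx); auto.
    exists x; split; auto. pose proof (inv_succ_pos n).
    destruct (Hx (/ (INR n + 1) / 2)) as (U & HU & Ux & Hosc); [lra|].
    exists U; repeat split; auto. intros y z Uy Uz.
    apply Hosc in Uy, Uz. apply Rabs_def2 in Uy, Uz. apply Rabs_def1; lra.
Qed.

(** At continuity points of [g], the preimage of [U] coincides with its [tau]-interior. *)
Lemma swiatkowski_baire_fun tau (g : R -> R) :
  category_topology tau -> swiatkowski tau g -> baire_fun g.
Proof.
intros Ht Hg U HU.
apply (baire_set_ext_residual _ (tau_interior tau (fun x => U (g x))) (cont_tau tau g)).
- now apply swiatkowski_cont_residual.
- intros x Hx; split.
  + intros Ux. destruct (proj1 (open_set_intervals U) HU _ Ux) as (c & d & Hcd & Hd).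
    destruct (Hx (Rmin (g x - c) (d - g x))) as (W & HW & Wx & Hosc).
    { apply Rmin_pos; lra. }
    pose proof (Rmin_l (g x - c) (d - g x)). pose proof (Rmin_r (g x - c) (d - g x)).
    exists W; repeat split; auto. intros y Wy.
    apply Hosc in Wy. apply Rabs_def2 in Wy. apply Hd; lra.
  + intros (W & [_ HW] & Wx). now apply HW.
- apply (tau_open_baire_set tau); auto. apply tau_interior_open, Ht.
Qed.

(* Let [V N] be the tau-interior of the set where some [|g_n - g_m|] with [n, m >= N]
   exceeds [eta].  If every [V N] were dense in (p, q), all of them would be residual
   there, against pointwise convergence; on an interval missed by [V N] the tails of the
   sequence are uniformly [eta]-Cauchy at all common continuity points. *)
Lemma lim_swiat_uniform_on_residual tau (g : nat -> R -> R) (f : R -> R) (eta p q : R) :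
  category_topology tau -> (forall n, swiatkowski tau (g n)) ->
  (forall x, Un_cv (fun n => g n x) (f x)) -> eta > 0 -> p < q ->
  exists p' q' N, p <= p' /\ p' < q' /\ q' <= q /\
    forall x n, p' < x < q' -> (forall i, cont_tau tau (g i) x) -> (N <= n)%nat ->
      Rabs (g n x - f x) <= eta.
Proof.
intros Ht Hg Hlim Heta Hpq.
pose (bad := fun N x => exists n m, (N <= n)%nat /\ (N <= m)%nat /\
  eta < Rabs (g n x - g m x)).
pose (V := fun N => tau_interior tau (bad N)).
assert (HVt : forall N, tau (V N)) by (intros; apply tau_interior_open, Ht).
destruct (classic (exists N p' q', p <= p' /\ p' < q' /\ q' <= q /\
  forall x, V N x -> ~ p' < x < q')) as [(N & p' & q' & H1 & H2 & H3 & H4)|Hn].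
- exists p', q', N; repeat split; auto. intros x n Hx Hc Hn.
  destruct (Rle_or_lt (Rabs (g n x - f x)) eta) as [|Hlt]; auto. exfalso.
  (* A third of the excess over [eta] for each of three errors: moving [g n] from [x] to [y], moving
     [g m] likewise, and replacing [f x] by [g m x]. *)
  set (e := (Rabs (g n x - f x) - eta) / 3).
  destruct (Hlim x e) as [M HM]; [unfold e; lra|].
  set (m := (N + M)%nat). specialize (HM m ltac:(lia)). unfold Rdist in HM.
  destruct (Hc n e) as (U & HU & Ux & HUe); [unfold e; lra|].
  destruct (Hc m e) as (W & HW & Wx & HWe); [unfold e; lra|].
  apply (H4 x); auto. exists (fun y => U y /\ W y). split; [split|]; auto.
  + destruct Ht as [(_ & _ & Hi & _) _]. now apply (Hi U W).
  + intros y [Uy Wy]. apply HUe in Uy. apply HWe in Wy.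
    exists n, m; repeat split; auto; [lia|].
    pose proof (Rabs_triang (g n x - g n y) (g n y - g m y)).
    pose proof (Rabs_triang (g n x - g m y) (g m y - g m x)).
    pose proof (Rabs_triang (g n x - g m x) (g m x - f x)).
    replace (g n x - g n y + (g n y - g m y)) with (g n x - g m y) in * by ring.
    replace (g n x - g m y + (g m y - g m x)) with (g n x - g m x) in * by ring.
    replace (g n x - g m x + (g m x - f x)) with (g n x - f x) in * by ring.
    rewrite (Rabs_minus_sym (g n x) (g n y)) in *. unfold e in *; lra.
- exfalso.
  assert (HM : meager (fun x => exists N, p < x < q /\ ~ V N x)).
  { apply (meager_countable_union (fun N x => p < x < q /\ ~ V N x)); intros N.
    apply (tau_open_dense_residual_in tau); auto; [apply open_set_interval|].
    intros r s Hrs Hsub. apply NNPP; intros Hno. apply Hn.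
    exists N, (Rmax p r), (Rmin q s).
    (* Otherwise the midpoint chosen below is a point of (r, s) outside (p, q). *)
    assert (p <= r /\ s <= q) as [Hpr Hsq].
    { split; apply Rnot_lt_le; intros Hlt.
      - set (x := (r + Rmin p s) / 2).
        pose proof (Rmin_l p s). pose proof (Rmin_r p s). pose proof (Rmin_glb_lt p s r).
        specialize (Hsub x); unfold x in *; lra.
      - set (x := (s + Rmax q r) / 2).
        pose proof (Rmax_l q r). pose proof (Rmax_r q r). pose proof (Rmax_lub_lt q r s).
        specialize (Hsub x); unfold x in *; lra. }
    rewrite Rmax_right, Rmin_right; auto. repeat split; try lra. intros x Vx Hx; eauto. }
  destruct (baire_category _ p q HM Hpq) as (x & Hx & Hall).
  destruct (Hlim x (eta / 2)) as [N HN]; [lra|].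
  destruct (classic (V N x)) as [(U & [_ HU] & Ux)|HV]; [|apply Hall; eauto].
  apply HU in Ux as (n & m & Hn' & Hm & Hlt).
  pose proof (HN n Hn') as Hxn. pose proof (HN m Hm) as Hxm. unfold Rdist in *.
  apply Rabs_def2 in Hxn, Hxm.
  apply (Rlt_irrefl eta), (Rlt_trans _ _ _ Hlt), Rabs_def1; lra.
Qed.

(** On an interval of almost uniform convergence, the point [x] that the Świątkowski condition gives
    for one [g n] is moved within a [tau]-neighbourhood to a point [y] of [A] where all [g i] are
    continuous; there [f] is close to [g n]. *)
Lemma lim_swiat_frakS tau (f : R -> R) :
  category_topology tau -> lim_swiat tau f -> frakS f.
Proof.
intros Ht (g & Hg & Hlim). split.
- apply (baire_fun_limit g); auto. intros n; now apply (swiatkowski_baire_fun tau).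
- intros A HA eps He p q Hpq.
  destruct (lim_swiat_uniform_on_residual tau g f (eps / 2) p q)
    as (p' & q' & N & H1 & H2 & H3 & Hu); auto; [lra|].
  exists p', q', ((p' + q') / 2). repeat split; try lra.
  intros a b Ha Hb Hab.
  (* The bound by half of [f b - f a] gives [g n a < g n b]; the bound [eps / 2] leaves another
     [eps / 2] for the distance from [g n y] to [f y]. *)
  set (e := Rmin (eps / 2) ((f b - f a) / 2)).
  assert (0 < e /\ e <= eps / 2 /\ e <= (f b - f a) / 2) as (He0 & He1 & He2).
  { unfold e; split; [apply Rmin_pos; lra|split; [apply Rmin_l|apply Rmin_r]]. }
  destruct (Hlim a e) as [Na HNa]; auto. destruct (Hlim b e) as [Nb HNb]; auto.
  set (n := (N + Na + Nb)%nat).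
  specialize (HNa n ltac:(lia)). specialize (HNb n ltac:(lia)). unfold Rdist in *.
  apply Rabs_def2 in HNa, HNb.
  destruct (Hg n a b) as (x & Hc & Hx & Hgx); [lra|].
  (* This radius keeps [g n] strictly between [g n a] and [g n b] on [U]. *)
  destruct (Hc (Rmin (g n x - g n a) (g n b - g n x))) as (U & HU & Ux & HUe).
  { apply Rmin_pos; lra. }
  destruct (tau_open_meets_residual tau (fun y => U y /\ Rmin a b < y < Rmax a b)
    (fun y => A y /\ forall i, cont_tau tau (g i) y)) as (y & (Uy & Hy) & Ay & Hcy); auto.
  + now apply tau_and_interval.
  + apply residual_and; auto. apply residual_countable_inter.
    intros i; now apply swiatkowski_cont_residual.
  + exists x; auto.
  + exists y; repeat split; auto; try apply Hy;
    (assert (Hyp : p' < y < q')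
      by (pose proof (Rmin_glb_lt a b p'); pose proof (Rmax_lub_lt a b q'); lra);
     specialize (Hu y n Hyp Hcy ltac:(lia));
     apply HUe in Uy;
     pose proof (Rmin_l (g n x - g n a) (g n b - g n x));
     pose proof (Rmin_r (g n x - g n a) (g n b - g n x));
     apply Rabs_def2 in Uy;
     pose proof (Rle_abs (g n y - f y)); pose proof (Rle_abs (- (g n y - f y)));
     rewrite Rabs_Ropp in *; lra).
Qed.

(** * Tame intervals *)

Definition continuous_on (f : R -> R) (B : R -> Prop) : Prop :=
  forall x, B x -> forall eps, eps > 0 ->
    exists c d, c < x < d /\ forall y, c < y < d -> B y -> Rabs (f y - f x) < eps.

Definition meets_intervals (B : R -> Prop) : Prop :=
  forall p q, p < q -> exists x, B x /\ p < x < q.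

Lemma residual_meets_intervals (B : R -> Prop) : residual B -> meets_intervals B.
Proof.
intros HB p q Hpq. destruct (baire_category _ p q HB Hpq) as (x & Hx & Bx).
exists x; split; auto. now apply NNPP.
Qed.

Lemma scaled_up (j : nat) (x : R) :
  (IZR (up (x * (INR j + 1))) - 1) / (INR j + 1) <= x
    < IZR (up (x * (INR j + 1))) / (INR j + 1).
Proof.
assert (Hj : 0 < INR j + 1) by (pose proof (pos_INR j); lra).
destruct (archimed (x * (INR j + 1))) as [H1 H2].
split.
- apply Rmult_le_reg_r with (INR j + 1); auto. unfold Rdiv.
  rewrite Rmult_assoc, Rinv_l; lra.
- apply Rmult_lt_reg_r with (INR j + 1); auto. unfold Rdiv.
  rewrite Rmult_assoc, Rinv_l; lra.
Qed.

Lemma IZR_diff_INR (z : Z) : exists a b : nat, IZR z = INR a - INR b.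
Proof.
exists (Z.to_nat z), (Z.to_nat (- z)). rewrite !INR_IZR_INZ, <- minus_IZR. f_equal; lia.
Qed.

Lemma baire_fun_continuous_on_residual (f : R -> R) :
  baire_fun f -> exists B, residual B /\ continuous_on f B.
Proof.
intros Hf.
(* Intervals of length 2/(j+1) with end-points in the multiples of 1/(j+1); they overlap, so at each
   scale every real lies in one. The integer is a difference of naturals so that countable
   intersections over [nat] apply. *)
pose (U := fun (j a b : nat) y => (INR a - INR b - 2) / (INR j + 1) < y < (INR a - INR b) / (INR j + 1)).
assert (HU : forall j a b, exists O, open_set O /\ meager (fun x => ~ (U j a b (f x) <-> O x))).
{ intros j a b. apply (baire_set_mod_meager (fun x => U j a b (f x))), Hf.
  apply open_set_interval. }
pose (O := fun j a b => proj1_sig (constructive_indefinite_description _ (HU j a b))).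
assert (HO : forall j a b, open_set (O j a b) /\ residual (fun x => U j a b (f x) <-> O j a b x)).
{ intros j a b; unfold O; destruct (constructive_indefinite_description _ (HU j a b)); auto. }
exists (fun x => forall j a b, U j a b (f x) <-> O j a b x); split.
- apply (residual_countable_inter (fun j x => forall a b, U j a b (f x) <-> O j a b x)); intros j.
  apply (residual_countable_inter (fun a x => forall b, U j a b (f x) <-> O j a b x)); intros a.
  apply (residual_countable_inter (fun b x => U j a b (f x) <-> O j a b x)); intros b.
  apply HO.
- intros x Bx eps He.
  destruct (inv_succ_small (eps / 2)) as [j Hj]; [lra|]. specialize (Hj j (le_n j)).
  pose proof (scaled_up j (f x)) as Hup.
  destruct (IZR_diff_INR (up (f x * (INR j + 1)))) as (a & b & Hab). rewrite Hab in Hup.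
  unfold Rdiv in Hup.
  assert (HUx : U j a b (f x)) by (unfold U, Rdiv; split; lra).
  destruct (proj1 (open_set_intervals _) (proj1 (HO j a b)) x) as (c & d & Hx & Hcd).
  { now apply Bx. }
  exists c, d; split; auto. intros y Hy By.
  assert (HUy : U j a b (f y)) by now apply By, Hcd.
  unfold U, Rdiv in HUx, HUy. apply Rabs_def1; lra.
Qed.

(* Besides [S_J] and small oscillation of [f] on [B], every value taken by [f] on (c, d)
   is approximated on [B], or taken again, in every subinterval; this makes the
   condition usable across overlapping intervals (see [tame_chain]), which [S_J] is not. *)
Definition tame (f : R -> R) (B : R -> Prop) (c d eps : R) : Prop :=
  S_J f c d B eps /\
  (forall x y, B x -> B y -> c < x < d -> c < y < d -> Rabs (f x - f y) <= eps) /\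
  (forall z r s, c < z < d -> c <= r -> r < s -> s <= d ->
    (exists z', r < z' < s /\ f z' = f z) \/
    (exists x, B x /\ r < x < s /\ Rabs (f x - f z) < eps)).

Lemma tame_sub (f : R -> R) (B : R -> Prop) (c d c' d' eps : R) :
  c <= c' -> d' <= d -> tame f B c d eps -> tame f B c' d' eps.
Proof.
intros Hc Hd (H1 & H2 & H3). repeat split.
- intros a b Ha Hb; apply H1; lra.
- intros x y Bx By Hx Hy; apply H2; auto; lra.
- intros z r s Hz Hr Hrs Hs; apply H3; auto; lra.
Qed.

Lemma tame_opp (f : R -> R) (B : R -> Prop) (c d eps : R) :
  tame f B c d eps -> tame (fun x => - f x) B c d eps.
Proof.
intros (H1 & H2 & H3). repeat split.
- intros a b Ha Hb Hab. destruct (H1 b a) as (x & Bx & Hx & Hf); auto; [lra|].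
  exists x; repeat split; auto; try lra; unfold in_I in Hx;
  rewrite Rmin_comm, Rmax_comm in Hx; apply Hx.
- intros x y Bx By Hx Hy. rewrite Rabs_minus_sym.
  replace (- f y - - f x) with (f x - f y) by ring. auto.
- intros z r s Hz Hr Hrs Hs. destruct (H3 z r s) as [(z' & Hz' & E)|(x & Bx & Hx & E)]; auto.
  + left; exists z'; split; auto. now rewrite E.
  + right; exists x; repeat split; try apply Hx; auto. rewrite Rabs_minus_sym.
    replace (- f z - - f x) with (f x - f z) by ring. auto.
Qed.

Lemma S_J_sub (f : R -> R) (A : R -> Prop) (c d c' d' eps : R) :
  c <= c' -> d' <= d -> S_J f c d A eps -> S_J f c' d' A eps.
Proof. intros Hc Hd H a b Ha Hb; apply H; lra. Qed.

(* In an interval satisfying [S_J f c d B eps] with [f] within [eps] of [y] on [B], two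
   values below [y - 2 * eps] must coincide, because [S_J] finds no point of [B] for them.
   Shrinking the interval makes the set of these points empty or dense. *)
Lemma S_J_low_dense (f : R -> R) (B : R -> Prop) (y c d eps : R) :
  c < d -> eps > 0 -> S_J f c d B eps ->
  (forall x, B x -> c < x < d -> Rabs (f x - y) < eps) ->
  exists c' d', c <= c' /\ c' < d' /\ d' <= d /\
    forall z r s, c' < z < d' -> f z <= y - 2 * eps -> c' <= r -> r < s -> s <= d' ->
      exists z', r < z' < s /\ f z' = f z.
Proof.
intros Hcd He HS Hosc.
assert (Heq : forall z z', c < z < d -> c < z' < d -> f z <= y - 2 * eps ->
  f z' <= y - 2 * eps -> f z' = f z).
{ assert (Hlt : forall z z', c < z < d -> c < z' < d -> f z <= y - 2 * eps ->
    f z < f z' -> f z' <= y - 2 * eps -> False).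
  { intros z z' Hz Hz' Hl Hlt Hl'. destruct (HS z z' Hz Hz' Hlt) as (x & Bx & [Hx1 Hx2] & Hf).
    assert (Hx : c < x < d)
      by (pose proof (Rmin_glb_lt z z' c); pose proof (Rmax_lub_lt z z' d); lra).
    specialize (Hosc x Bx Hx). apply Rabs_def2 in Hosc; lra. }
  intros z z' Hz Hz' Hl Hl'. destruct (Rtotal_order (f z') (f z)) as [H|[H|H]]; auto; exfalso.
  - apply (Hlt z' z); auto.
  - apply (Hlt z z'); auto. }
destruct (classic (exists c' d', c <= c' /\ c' < d' /\ d' <= d /\
  forall z, c' < z < d' -> y - 2 * eps < f z)) as [(c' & d' & H1 & H2 & H3 & H4)|Hn].
- exists c', d'; repeat split; auto. intros z r s Hz Hl. specialize (H4 z Hz); lra.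
- exists c, d; repeat split; try lra. intros z r s Hz Hl Hr Hrs Hs.
  apply NNPP; intros Hno. apply Hn. exists r, s; repeat split; auto.
  intros z' Hz'. apply Rnot_le_lt; intros Hl'. apply Hno. exists z'; split; auto.
  apply Heq; auto; lra.
Qed.

(** Inside an interval with [S_J], relative continuity gives one where [f] is almost constant on
    [B]. After two more shrinkings, values of [f] far below or far above that constant are taken
    densely, and all others are close to the values on [B]. *)
Lemma tame_dense (f : R -> R) (B : R -> Prop) (eps p q : R) :
  frakS f -> residual B -> continuous_on f B -> eps > 0 -> p < q ->
  exists c d, p <= c /\ c < d /\ d <= q /\ tame f B c d eps.
Proof.
intros [_ HS] HB Hc He Hpq.
pose proof (residual_meets_intervals B HB) as HBd.
(* On [B], [f] stays within [e] of [f x0], so it oscillates by at most [2 * e] there; a value within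
   [2 * e] of [f x0] is within [3 * e] of each of these. *)
set (e := eps / 4).
destruct (HS B HB e ltac:(unfold e; lra) p q Hpq) as (c0 & d0 & w & Hcd0 & HS0 & Hw & Hw').
assert (Hl : Rmax c0 p < w) by (apply Rmax_lub_lt; lra).
assert (Hr : w < Rmin d0 q) by (apply Rmin_glb_lt; lra).
pose proof (Rmax_l c0 p). pose proof (Rmax_r c0 p).
pose proof (Rmin_l d0 q). pose proof (Rmin_r d0 q).
destruct (HBd (Rmax c0 p) (Rmin d0 q)) as (x0 & Bx0 & Hx0); [lra|].
destruct (Hc x0 Bx0 e) as (c1 & d1 & Hx1 & Hosc); [unfold e; lra|].
set (c2 := Rmax c1 (Rmax c0 p)). set (d2 := Rmin d1 (Rmin d0 q)).
assert (c1 <= c2 /\ Rmax c0 p <= c2 /\ c2 < x0) as (? & ? & ?).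
{ unfold c2; split; [apply Rmax_l|split; [apply Rmax_r|apply Rmax_lub_lt; lra]]. }
assert (d2 <= d1 /\ d2 <= Rmin d0 q /\ x0 < d2) as (? & ? & ?).
{ unfold d2; split; [apply Rmin_l|split; [apply Rmin_r|apply Rmin_glb_lt; lra]]. }
assert (Hosc2 : forall x, B x -> c2 < x < d2 -> Rabs (f x - f x0) < e).
{ intros x Bx Hx; apply Hosc; auto; lra. }
assert (HS2 : S_J f c2 d2 B e) by (apply (S_J_sub f B c0 d0); auto; lra).
destruct (S_J_low_dense f B (f x0) c2 d2 e) as (c3 & d3 & ? & ? & ? & Hlow); auto;
  [lra|unfold e; lra|].
(* High values of [f] are low values of its negative; what was gained for low values persists in the
   smaller interval. *)
destruct (S_J_low_dense (fun x => - f x) B (- f x0) c3 d3 e) as (c4 & d4 & ? & ? & ? & Hhigh);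
  auto; [unfold e; lra| | |].
- intros a b Ha Hb Hab. destruct (HS2 b a) as (x & Bx & Hx & Hf); try lra.
  exists x; repeat split; auto; try lra; unfold in_I in Hx;
  rewrite Rmin_comm, Rmax_comm in Hx; apply Hx.
- intros x Bx Hx. rewrite Rabs_minus_sym.
  replace (- f x0 - - f x) with (f x - f x0) by ring. apply Hosc2; auto; lra.
- exists c4, d4; repeat split; try lra.
  + intros a b Ha Hb Hab. destruct (HS2 a b) as (x & Bx & Hx & Hf); try lra.
    exists x; repeat split; auto; unfold e in *; try lra; apply Hx.
  + intros x y Bx By Hx Hy. pose proof (Hosc2 x Bx ltac:(lra)) as Hox.
    pose proof (Hosc2 y By ltac:(lra)) as Hoy. apply Rabs_def2 in Hox, Hoy.
    apply Rlt_le, Rabs_def1; unfold e in *; lra.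
  + intros z r s Hz Hr' Hrs Hs.
    destruct (Rle_or_lt (f z) (f x0 - 2 * e)) as [Hzl|Hzl].
    { left; apply Hlow; lra. }
    destruct (Rle_or_lt (- f z) (- f x0 - 2 * e)) as [Hzh|Hzh].
    { left. destruct (Hhigh z r s) as (z' & Hz' & E); auto. exists z'; split; auto; lra. }
    right. destruct (HBd r s Hrs) as (x & Bx & Hx). exists x; repeat split; try apply Hx; auto.
    pose proof (Hosc2 x Bx ltac:(lra)) as Hox. apply Rabs_def2 in Hox.
    apply Rabs_def1; unfold e in *; lra.
Qed.

(** * Connectedness arguments along tame intervals *)

(** Connectedness of [a, b]: the supremum of the points satisfying [P] satisfies it as well, and it
    cannot lie below [b], since near it [P] passes to points further right. *)
Lemma segment_induction (P : R -> Prop) (a b : R) :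
  a <= b -> P a ->
  (forall t, a <= t <= b -> exists c d, c < t < d /\
     forall s s', c < s < d -> c < s' < d -> a <= s <= b -> a <= s' <= b -> P s -> P s') ->
  P b.
Proof.
intros Hab Pa Hloc.
destruct (completeness (fun t => a <= t <= b /\ P t)) as [s [Hub Hlub]].
- exists b; intros t [Ht _]; lra.
- exists a; split; auto; lra.
- assert (Has : a <= s) by (apply Hub; split; auto; lra).
  assert (Hsb : s <= b) by (apply Hlub; intros t [Ht _]; lra).
  destruct (Hloc s) as (c & d & Hs & Hstep); auto.
  assert (Ht : exists t, c < t < d /\ a <= t <= b /\ P t).
  { apply NNPP; intros Hn. assert (s <= c); [|lra].
    apply Hlub. intros t [Ht Pt]. apply Rnot_lt_le; intros Hct. apply Hn.
    exists t; repeat split; auto; try lra.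
    assert (t <= s) by (apply Hub; auto). lra. }
  destruct Ht as (t & Ht & Ht' & Pt).
  destruct (Rle_lt_or_eq_dec _ _ Hsb) as [Hlt|<-].
  + exfalso. set (s' := (s + Rmin b d) / 2).
    pose proof (Rmin_l b d). pose proof (Rmin_r b d).
    assert (s < Rmin b d) by (apply Rmin_glb_lt; lra).
    assert (s' <= s); [|unfold s' in *; lra].
    apply Hub; split; [unfold s'; lra|]. apply (Hstep t); auto; unfold s'; lra.
  + apply (Hstep t); auto; lra.
Qed.

(** The intersection of [a, b] and [c, d] is nondegenerate even if [t] is an end-point of [a, b]. *)
Lemma sub_interval (a b c d t : R) :
  a < b -> a <= t <= b -> c < t < d ->
  exists r s, r < s /\ c <= r /\ a <= r /\ s <= d /\ s <= b /\ (r <= t <= s).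
Proof.
intros Hab Ht Hcd. exists (Rmax a c), (Rmin b d).
repeat split; try apply Rmax_l; try apply Rmax_r; try apply Rmin_l; try apply Rmin_r.
- apply Rmax_lub_lt; apply Rmin_glb_lt; lra.
- apply Rmax_lub; lra.
- apply Rmin_glb; lra.
Qed.

(* Values not exceeding [hi] are out of reach of [f] on [B], so each of them, once taken,
   is taken densely by [tame], while [S_J] forbids two of them in one tame interval;
   hence the value [f a] propagates from [a] to [b]. *)
Lemma tame_chain_above (f : R -> R) (B : R -> Prop) (a b hi : R) :
  a < b -> f a <> f b -> f a <= hi -> f b <= hi ->
  (forall t, a <= t <= b -> exists c d eps, c < t < d /\ tame f B c d eps /\
     forall x, B x -> c < x < d -> a < x < b -> hi + eps <= f x) ->
  False.
Proof.
intros Hab Hne Ha Hb Hloc.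
(* The property to propagate: in [a, b] the value [f a] is taken arbitrarily near [s], or at [s]
   itself. *)
pose (P := fun s => forall r r', r < s < r' -> exists z, r < z < r' /\ a <= z <= b /\ f z = f a).
assert (Hstep : forall t, a <= t <= b -> exists c d, c < t < d /\
     forall s s', c < s < d -> c < s' < d -> a <= s <= b -> a <= s' <= b -> P s -> P s').
{ intros t Ht. destruct (Hloc t Ht) as (c & d & eps & Hcd & (_ & _ & HE) & HB).
  exists c, d; split; auto. intros s s' Hs Hs' Hsab Hs'ab Ps r r' Hr.
  destruct (Ps c d Hs) as (z & Hz & Hzab & Ez).
  destruct (sub_interval a b (Rmax c r) (Rmin d r') s') as (l & l' & H1 & H2 & H3 & H4 & H5 & _);
    auto.
  { split; [apply Rmax_lub_lt|apply Rmin_glb_lt]; lra. }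
  pose proof (Rmax_l c r). pose proof (Rmax_r c r).
  pose proof (Rmin_l d r'). pose proof (Rmin_r d r').
  destruct (HE z l l') as [(z' & Hz' & E)|(x & Bx & Hx & Hf)]; try lra.
  - exists z'; repeat split; lra.
  - exfalso. specialize (HB x Bx ltac:(lra) ltac:(lra)). apply Rabs_def2 in Hf; lra. }
assert (Pb : P b).
{ apply (segment_induction P a b); auto; [lra|].
  intros r r' Hr; exists a; repeat split; lra. }
destruct (Hloc b) as (c & d & eps & Hcd & (HS & _ & _) & HB); [lra|].
destruct (Pb c d Hcd) as (z & Hz & Hzab & Ez).
assert (Hzb : z < b).
{ destruct (Rle_lt_or_eq_dec _ _ (proj2 Hzab)); auto. congruence. }
(* For unequal values up to [hi], [S_J] would give a point of [B] in (a, b) with value below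
   [hi + eps]. *)
assert (Hno : forall u v, c < u < d -> c < v < d -> a <= u <= b -> a <= v <= b ->
  f u < f v -> f v <= hi -> False).
{ intros u v Hu Hv Hu' Hv' Hlt Hv0. destruct (HS u v Hu Hv Hlt) as (x & Bx & [Hx1 Hx2] & Hf).
  pose proof (Rmin_glb u v a). pose proof (Rmax_lub u v b).
  pose proof (Rmin_glb_lt u v c). pose proof (Rmax_lub_lt u v d).
  specialize (HB x Bx ltac:(lra) ltac:(lra)). lra. }
destruct (Rtotal_order (f z) (f b)) as [H|[H|H]].
- apply (Hno z b); auto; lra.
- congruence.
- apply (Hno b z); auto; lra.
Qed.

(* If [f] on [B] avoids the enlarged range of [f a, f b], then by its small oscillation it
   stays on one side of it. *)
Lemma tame_chain (f : R -> R) (B : R -> Prop) (a b lo hi : R) :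
  a < b -> lo < hi -> f a <> f b -> lo <= f a <= hi -> lo <= f b <= hi ->
  meets_intervals B ->
  (forall t, a <= t <= b -> exists c d eps, c < t < d /\ eps > 0 /\ tame f B c d eps /\
     forall x, B x -> c < x < d -> a < x < b -> hi + eps <= f x \/ f x <= lo - eps) ->
  False.
Proof.
intros Hab Hlohi Hne Ha Hb HBd Hloc.
assert (Hside : forall t, a <= t <= b -> exists c d eps, c < t < d /\ eps > 0 /\
  tame f B c d eps /\
  ((forall x, B x -> c < x < d -> a < x < b -> hi + eps <= f x) \/
   (forall x, B x -> c < x < d -> a < x < b -> f x <= lo - eps))).
{ intros t Ht. destruct (Hloc t Ht) as (c & d & eps & Hcd & He & HT & HB).
  exists c, d, eps. do 3 (split; auto). destruct HT as (_ & HO & _).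
  destruct (classic (exists x, B x /\ c < x < d /\ a < x < b /\ hi + eps <= f x))
    as [(x & Bx & Hx & Hx' & Hfx)|Hn].
  - left. intros y By Hy Hy'. destruct (HB y By Hy Hy') as [|Hlow]; auto.
    specialize (HO x y Bx By Hx Hy). pose proof (Rle_abs (f x - f y)). lra.
  - right. intros y By Hy Hy'. destruct (HB y By Hy Hy') as [Hh|]; auto.
    exfalso; apply Hn; exists y; auto. }
(* [P s] says that [f] on [B] lies on the high side near [s]; it is locally constant, so one side
   serves all of [a, b]. *)
pose (P := fun s => exists c d, c < s < d /\ forall x, B x -> c < x < d -> a < x < b -> hi <= f x).
assert (Hstep : forall t, a <= t <= b -> exists c d, c < t < d /\
     forall s s', c < s < d -> c < s' < d -> a <= s <= b -> a <= s' <= b -> P s <-> P s').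
{ intros t Ht. destruct (Hside t Ht) as (c & d & eps & Hcd & He & _ & [HB|HB]); exists c, d;
    split; auto; intros s s' Hs Hs' Hsab Hs'ab.
  - split; intros _; exists c, d; split; auto; intros x Bx Hx Hx';
    specialize (HB x Bx Hx Hx'); lra.
  - assert (Hnot : forall s, c < s < d -> a <= s <= b -> ~ P s).
    { intros r Hr Hrab (l & l' & Hl & Hll).
      destruct (sub_interval a b (Rmax c l) (Rmin d l') r) as (m & m' & H1 & H2 & H3 & H4 & H5 & _);
        auto.
      { split; [apply Rmax_lub_lt|apply Rmin_glb_lt]; lra. }
      pose proof (Rmax_l c l). pose proof (Rmax_r c l).
      pose proof (Rmin_l d l'). pose proof (Rmin_r d l').
      destruct (HBd m m' H1) as (x & Bx & Hx).
      specialize (Hll x Bx ltac:(lra) ltac:(lra)). specialize (HB x Bx ltac:(lra) ltac:(lra)).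
      lra. }
    pose proof (Hnot s Hs Hsab). pose proof (Hnot s' Hs' Hs'ab). tauto. }
assert (Hconst : forall t, a <= t <= b -> (P a <-> P t)).
{ intros t Ht. apply (segment_induction (fun t => P a <-> P t) a t); try tauto.
  intros u Hu. destruct (Hstep u) as (c & d & Hcd & H); [lra|].
  exists c, d; split; auto. intros s s' Hs Hs' Hsab Hs'ab E.
  rewrite E. apply H; auto; lra. }
assert (Hmeet : forall t c d, a <= t <= b -> c < t < d -> exists x, B x /\ c < x < d /\ a < x < b).
{ intros t c d Ht Hcd.
  destruct (sub_interval a b c d t) as (m & m' & H1 & H2 & H3 & H4 & H5 & _); auto.
  destruct (HBd m m' H1) as (x & Bx & Hx). exists x; repeat split; auto; lra. }
destruct (classic (P a)) as [Pa|Pa].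
- apply (tame_chain_above f B a b hi); try lra. intros t Ht.
  destruct (Hside t Ht) as (c & d & eps & Hcd & He & HT & [HB|HB]).
  { exists c, d, eps; auto. }
  exfalso. destruct (proj1 (Hconst t Ht) Pa) as (l & l' & Hl & Hll).
  destruct (Hmeet t (Rmax c l) (Rmin d l')) as (x & Bx & Hx & Hx'); auto.
  { split; [apply Rmax_lub_lt|apply Rmin_glb_lt]; lra. }
  pose proof (Rmax_l c l). pose proof (Rmax_r c l).
  pose proof (Rmin_l d l'). pose proof (Rmin_r d l').
  specialize (Hll x Bx ltac:(lra) Hx'). specialize (HB x Bx ltac:(lra) Hx'). lra.
(* The low side is the high side for the negative of [f], with bound [- lo]. *)
- apply (tame_chain_above (fun x => - f x) B a b (- lo)); try lra. intros t Ht.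
  destruct (Hside t Ht) as (c & d & eps & Hcd & He & HT & [HB|HB]).
  + exfalso. apply Pa, (Hconst t Ht). exists c, d; split; auto.
    intros x Bx Hx Hx'. specialize (HB x Bx Hx Hx'); lra.
  + exists c, d, eps; split; auto. split; [now apply tame_opp|].
    intros x Bx Hx Hx'. specialize (HB x Bx Hx Hx'); lra.
Qed.

(** * Oscillating functions on the gaps of a closed set *)

Lemma continuity_pt_intervals (g : R -> R) (x : R) :
  continuity_pt g x <->
  forall eps, eps > 0 -> exists c d, c < x < d /\ forall y, c < y < d -> Rabs (g y - g x) < eps.
Proof.
split.
- intros H eps He. destruct (H eps He) as (al & Hal & Hd).
  exists (x - al), (x + al); split; [lra|]. intros y Hy.
  destruct (Req_dec x y) as [<-|Hne]; [rewrite Rminus_diag, Rabs_R0; auto|].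
  apply Hd; split; [now split|]. simpl; unfold Rdist. apply Rabs_def1; lra.
- intros H eps He. destruct (H eps He) as (c & d & Hx & Hd).
  exists (Rmin (x - c) (d - x)); split; [apply Rmin_pos; lra|].
  intros y [_ Hy]. simpl in *; unfold Rdist in *. apply Rabs_def2 in Hy.
  pose proof (Rmin_l (x - c) (d - x)). pose proof (Rmin_r (x - c) (d - x)). apply Hd; lra.
Qed.

Lemma continuity_pt_eq_on (g h : R -> R) (u v x : R) :
  u < x < v -> (forall y, u < y < v -> g y = h y) -> continuity_pt h x -> continuity_pt g x.
Proof.
intros Hx Hgh Hh. apply continuity_pt_intervals. intros eps He.
destruct (proj1 (continuity_pt_intervals h x) Hh eps He) as (c & d & Hcd & Hd).
exists (Rmax u c), (Rmin v d). split.
- split; [apply Rmax_lub_lt|apply Rmin_glb_lt]; lra.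
- intros y Hy. pose proof (Rmax_l u c). pose proof (Rmax_r u c).
  pose proof (Rmin_l v d). pose proof (Rmin_r v d).
  rewrite !Hgh by lra. apply Hd; lra.
Qed.

Lemma cont_tau_of_continuity_pt tau (g : R -> R) (x : R) :
  (forall U, open_set U -> tau U) -> continuity_pt g x -> cont_tau tau g x.
Proof.
intros Ho Hc eps He.
destruct (proj1 (continuity_pt_intervals g x) Hc eps He) as (c & d & Hcd & Hd).
exists (fun y => c < y < d); repeat split; try lra; auto. apply Ho, open_set_interval.
Qed.

Lemma in_I_comm (a b x : R) : in_I a b x <-> in_I b a x.
Proof. unfold in_I. rewrite Rmin_comm, Rmax_comm. tauto. Qed.

Lemma in_I_cases (a b x : R) : in_I a b x <-> a < x < b \/ b < x < a.
Proof.
unfold in_I, Rmin, Rmax. destruct (Rle_dec a b); lra.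
Qed.

Lemma intermediate_value (g : R -> R) (x z y : R) :
  (forall t, Rmin x z <= t <= Rmax x z -> continuity_pt g t) -> in_I (g x) (g z) y ->
  exists t, in_I x z t /\ g t = y.
Proof.
assert (Hlt : forall (g : R -> R) x z y, x < z ->
  (forall t, x <= t <= z -> continuity_pt g t) -> g x < y < g z ->
  exists t, x < t < z /\ g t = y).
{ clear. intros g x z y Hxz Hc Hy.
  destruct (Ranalysis5.IVT_interv (fun t => g t - y) x z) as (t & Ht & E); try lra.
  - intros t Ht. apply continuity_pt_minus; [auto|].
    apply continuity_pt_const. intros ? ?; reflexivity.
  - exists t; split; [|lra].
    destruct (proj1 Ht), (proj2 Ht); subst; lra. }
assert (Hw : forall x z, x < z -> (forall t, x <= t <= z -> continuity_pt g t) ->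
  in_I (g x) (g z) y -> exists t, x < t < z /\ g t = y).
{ clear x z. intros x z Hxz Hc Hy. apply in_I_cases in Hy as [Hy|Hy].
  - now apply (Hlt g).
  - destruct (Hlt (fun t => - g t) x z (- y)) as (t & Ht & E); auto; try lra.
    + intros t Ht. apply continuity_pt_opp; auto.
    + exists t; split; auto; lra. }
intros Hc Hy. destruct (Rtotal_order x z) as [H|[<-|H]].
- rewrite Rmin_left, Rmax_right in Hc by lra.
  destruct (Hw x z H Hc Hy) as (t & Ht & E). exists t; rewrite in_I_cases; auto.
- apply in_I_cases in Hy; lra.
- rewrite Rmin_right, Rmax_left in Hc by lra. apply in_I_comm in Hy.
  destruct (Hw z x H Hc Hy) as (t & Ht & E). exists t; rewrite in_I_cases; auto.
Qed.

(** [V] is the range of [g] on (u, v), and since [x] is arbitrary, each of its values is taken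
    arbitrarily near both ends. *)
Definition oscillates (u v : R) (V : R -> Prop) (g : R -> R) : Prop :=
  (forall x, u < x < v -> continuity_pt g x) /\
  (forall x, u < x < v -> V (g x)) /\
  (forall y x, V y -> u < x < v ->
     (exists x1, u < x1 < x /\ g x1 = y) /\ (exists x2, x < x2 < v /\ g x2 = y)).

(** Each end contributes a term t sin t, with t the inverse distance to that end; near one end the
    other term stays bounded. *)
Definition wild (u v x : R) : R :=
  / (x - u) * sin (/ (x - u)) + / (v - x) * sin (/ (v - x)).

Lemma sin_large_arg (sgn K : R) :
  sgn = 1 \/ sgn = -1 -> exists s, K < s /\ sin s = sgn.
Proof.
intros Hs. destruct (INR_unbounded (Rabs K)) as [n Hn].
exists (sgn * (PI / 2) + 2 * INR (S n) * PI). split.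
- pose proof PI2_1. pose proof (Rle_abs K). pose proof (pos_INR n).
  rewrite S_INR. assert (INR n * 1 <= INR n * PI) by (apply Rmult_le_compat_l; lra).
  destruct Hs as [-> | ->]; lra.
- rewrite sin_period. destruct Hs as [-> | ->].
  + rewrite Rmult_1_l. apply sin_PI2.
  + replace (-1 * (PI / 2)) with (- (PI / 2)) by ring. rewrite sin_neg, sin_PI2; ring.
Qed.

Lemma wild_continuity (u v x : R) : u < x < v -> continuity_pt (wild u v) x.
Proof. intros Hx. unfold wild. reg; lra. Qed.

Lemma wild_sym (u v x : R) : wild u v (u + v - x) = wild u v x.
Proof.
unfold wild. replace (u + v - x - u) with (v - x) by ring.
replace (v - (u + v - x)) with (x - u) by ring. ring.
Qed.

Lemma wild_left_unbounded (u v x sgn K : R) :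
  u < x < v -> sgn = 1 \/ sgn = -1 ->
  exists z, u < z < x /\ K < sgn * wild u v z.
Proof.
intros Hx Hs.
(* The first bound puts u + 1/s to the left of [x]; the second absorbs the other term, which left of
   [x] is at most 1/(v-x) in absolute value. *)
destruct (sin_large_arg sgn (Rmax (/ (x - u)) (K + / (v - x))) Hs) as (s & Hsl & Hss).
pose proof (Rmax_l (/ (x - u)) (K + / (v - x))). pose proof (Rmax_r (/ (x - u)) (K + / (v - x))).
assert (0 < / (x - u)) by (apply Rinv_0_lt_compat; lra).
assert (Hs0 : 0 < / s) by (apply Rinv_0_lt_compat; lra).
assert (Hzx : / s < x - u).
{ rewrite <- (Rinv_inv (x - u)). apply Rinv_lt_contravar; [apply Rmult_lt_0_compat|]; lra. }
exists (u + / s). split; [lra|].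
unfold wild. replace (u + / s - u) with (/ s) by ring. rewrite Rinv_inv, Hss.
set (w := v - (u + / s)).
assert (Hw : 0 < / w < / (v - x)).
{ split; [apply Rinv_0_lt_compat|apply Rinv_lt_contravar; [apply Rmult_lt_0_compat|]];
  unfold w; lra. }
pose proof (SIN_bound (/ w)).
assert (Hb : - / w <= / w * sin (/ w) <= / w) by nra.
destruct Hs as [-> | ->]; lra.
Qed.

Lemma wild_hits_left (u v x y : R) : u < x < v -> exists z, u < z < x /\ wild u v z = y.
Proof.
intros Hx.
destruct (wild_left_unbounded u v x 1 y Hx (or_introl eq_refl)) as (z1 & Hz1 & H1).
destruct (wild_left_unbounded u v x (-1) (- y) Hx (or_intror eq_refl)) as (z2 & Hz2 & H2).
destruct (intermediate_value (wild u v) z1 z2 y) as (z & Hz & E).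
- intros t Ht. apply wild_continuity.
  pose proof (Rmin_glb_lt z1 z2 u). pose proof (Rmax_lub_lt z1 z2 v). lra.
- apply in_I_cases; lra.
- exists z; split; auto. apply in_I_cases in Hz. lra.
Qed.

Lemma wild_oscillates (u v : R) (V : R -> Prop) : (forall y, V y) -> oscillates u v V (wild u v).
Proof.
intros HV. split; [intros x; apply wild_continuity|split; auto].
intros y x _ Hx; split; [now apply wild_hits_left|].
destruct (wild_hits_left u v (u + v - x) y) as (z & Hz & E); [lra|].
exists (u + v - z); split; [lra|]. now rewrite wild_sym.
Qed.

(** The factor [2 * e / PI] carries the range of [atan] onto (-e, e), and [tan] tells which value
    [wild] has to hit. *)
Lemma atan_wild_oscillates (u v c e : R) (V : R -> Prop) :
  e > 0 -> (forall y, V y <-> Rabs (y - c) < e) ->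
  oscillates u v V (fun x => c + 2 * e / PI * atan (wild u v x)).
Proof.
intros He HV.
destruct (wild_oscillates u v (fun _ => True)) as (W1 & _ & W3); auto.
pose proof PI_RGT_0 as HPI.
assert (Hk : 0 < 2 * e / PI) by (apply Rdiv_lt_0_compat; lra).
assert (Hkk : 2 * e / PI * (PI / 2) = e) by (field; lra).
repeat split.
- intros x Hx. apply continuity_pt_plus; [apply continuity_pt_const; intros ? ?; reflexivity|].
  apply continuity_pt_mult; [apply continuity_pt_const; intros ? ?; reflexivity|].
  apply (continuity_pt_comp (wild u v) atan); auto.
  apply derivable_continuous_pt, derivable_pt_atan.
- intros x Hx. apply HV. pose proof (atan_bound (wild u v x)).
  apply Rabs_def1; nra.
- intros; edestruct (W3 (tan ((y - c) / (2 * e / PI))) x) as [(z & Hz & E) _]; auto.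
  exists z; split; auto. rewrite E, atan_tan; [field; lra|].
  apply HV, Rabs_def2 in H.
  split; apply Rmult_lt_reg_l with (2 * e / PI); auto; unfold Rdiv in *;
  rewrite ?(Rmult_comm (y - c)), <- ?Rmult_assoc, ?Rinv_r, ?Rmult_1_l by lra; lra.
- intros; edestruct (W3 (tan ((y - c) / (2 * e / PI))) x) as [_ (z & Hz & E)]; auto.
  exists z; split; auto. rewrite E, atan_tan; [field; lra|].
  apply HV, Rabs_def2 in H.
  split; apply Rmult_lt_reg_l with (2 * e / PI); auto; unfold Rdiv in *;
  rewrite ?(Rmult_comm (y - c)), <- ?Rmult_assoc, ?Rinv_r, ?Rmult_1_l by lra; lra.
Qed.

(** * Closed nowhere dense sets and their gaps *)

Definition closed_nowhere_dense (A : R -> Prop) : Prop :=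
  (forall x, ~ A x -> exists c d, c < x < d /\ forall y, c < y < d -> ~ A y) /\
  meets_intervals (fun x => ~ A x).

Lemma closed_nowhere_dense_or (A B : R -> Prop) :
  closed_nowhere_dense A -> closed_nowhere_dense B ->
  closed_nowhere_dense (fun x => A x \/ B x).
Proof.
assert (Hc : forall C : R -> Prop,
  (forall x, ~ C x -> exists c d, c < x < d /\ forall y, c < y < d -> ~ C y) ->
  open_set (fun x => ~ C x)).
{ intros C H. now apply open_set_intervals. }
intros [HA1 HA2] [HB1 HB2]. split.
- intros x Hx. destruct (HA1 x) as (c & d & Hcd & H); [tauto|].
  destruct (HB1 x) as (c' & d' & Hcd' & H'); [tauto|].
  exists (Rmax c c'), (Rmin d d'); split.
  + split; [apply Rmax_lub_lt|apply Rmin_glb_lt]; lra.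
  + intros y Hy. pose proof (Rmax_l c c'). pose proof (Rmax_r c c').
    pose proof (Rmin_l d d'). pose proof (Rmin_r d d').
    intros [Ay|By]; [apply (H y)|apply (H' y)]; auto; lra.
- intros p q Hpq.
  destruct (open_shrink _ p q (Hc A HA1) (HA2 p q Hpq)) as (p' & q' & H1 & H2 & H3 & H4).
  destruct (HB2 p' q' H2) as (x & Bx & Hx). exists x; split; [|lra].
  specialize (H4 x Hx). tauto.
Qed.

Lemma closed_nowhere_dense_meager (A : R -> Prop) : closed_nowhere_dense A -> meager A.
Proof.
intros [H1 H2]. apply nowhere_dense_meager. intros p q Hpq.
apply open_shrink; auto. now apply open_set_intervals.
Qed.

Lemma adherence_closed_nowhere_dense (A : R -> Prop) :
  nowhere_dense A -> closed_nowhere_dense (adherence A).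
Proof.
intros H. split.
- apply (proj1 (open_set_intervals _)), adherence_P3.
- intros p q Hpq. apply NNPP; intros Hn. apply (H ((p + q) / 2)).
  assert (He : 0 < (q - p) / 2) by lra. exists (mkposreal _ He).
  intros y Hy; unfold disc in Hy; simpl in Hy. apply Rabs_def2 in Hy.
  apply NNPP; intros Ha. apply Hn. exists y; split; auto; lra.
Qed.

(** The multiples of 1/(j+1). Grid 0 makes all gaps bounded; the finer grids make the gaps around a
    fixed point shrink. *)
Definition grid (j : nat) (x : R) : Prop := exists z : Z, x * (INR j + 1) = IZR z.

Lemma grid_closed_nowhere_dense (j : nat) : closed_nowhere_dense (grid j).
Proof.
assert (Hj : 0 < INR j + 1) by (pose proof (pos_INR j); lra).
assert (Hcell : forall (z : Z) x, (IZR z - 1) / (INR j + 1) < x < IZR z / (INR j + 1) -> ~ grid j x).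
{ intros z x [H1 H2] [z' E].
  assert (H1' : IZR (z - 1) < IZR z').
  { rewrite <- E, minus_IZR. apply Rmult_lt_compat_r with (r := INR j + 1) in H1; auto.
    unfold Rdiv in H1. rewrite Rmult_assoc, Rinv_l in H1; lra. }
  assert (H2' : IZR z' < IZR z).
  { rewrite <- E. apply Rmult_lt_compat_r with (r := INR j + 1) in H2; auto.
    unfold Rdiv in H2. rewrite Rmult_assoc, Rinv_l in H2; lra. }
  apply lt_IZR in H1', H2'. lia. }
split.
- intros x Hx. pose proof (scaled_up j x) as [H1 H2].
  exists ((IZR (up (x * (INR j + 1))) - 1) / (INR j + 1)), (IZR (up (x * (INR j + 1))) / (INR j + 1)).
  split; [|apply Hcell]. split; auto.
  destruct H1 as [|E]; auto. exfalso. apply Hx. exists (up (x * (INR j + 1)) - 1)%Z.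
  rewrite minus_IZR, <- E at 1. field; lra.
- intros p q Hpq. pose proof (scaled_up j p) as [H1 H2].
  set (z := up (p * (INR j + 1))) in *.
  assert (p < Rmin q (IZR z / (INR j + 1))) by (apply Rmin_glb_lt; lra).
  pose proof (Rmin_l q (IZR z / (INR j + 1))). pose proof (Rmin_r q (IZR z / (INR j + 1))).
  exists ((p + Rmin q (IZR z / (INR j + 1))) / 2); split; [|lra].
  apply (Hcell z); lra.
Qed.

Lemma grid_dense (p q : R) : p < q -> exists j y, grid j y /\ p < y < q.
Proof.
intros Hpq. destruct (inv_succ_small (q - p)) as [j Hj]; [lra|].
specialize (Hj j (le_n j)). pose proof (scaled_up j p) as [H1 H2].
exists j, (IZR (up (p * (INR j + 1))) / (INR j + 1)). unfold Rdiv in *.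
split; [|lra].
exists (up (p * (INR j + 1))). field. pose proof (pos_INR j); lra.
Qed.

Lemma grid_unbounded (x : R) : (exists y, grid 0 y /\ y < x) /\ (exists y, grid 0 y /\ x < y).
Proof.
destruct (archimed x) as [H1 H2]. split.
- exists (IZR (up x - 2)); split; [|rewrite minus_IZR; lra].
  exists (up x - 2)%Z; simpl; ring.
- exists (IZR (up x)); split; [|lra]. exists (up x); simpl; ring.
Qed.

Lemma increasing_closed_cover (C : nat -> R -> Prop) :
  (forall j, closed_nowhere_dense (C j)) ->
  exists F : nat -> R -> Prop,
    (forall n, closed_nowhere_dense (F n)) /\
    (forall n x, F n x <-> exists j, (j <= n)%nat /\ C j x).
Proof.
intros HC. exists (fix F n := match n with
  | O => C O | S m => fun x => F m x \/ C (S m) x end). split.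
- intros n; induction n; auto. now apply closed_nowhere_dense_or.
- intros n; induction n as [|n IH]; intros x.
  + split; [exists 0%nat; auto|]. intros (j & Hj & H). replace 0%nat with j by lia; auto.
  + simpl. rewrite IH. split.
    * intros [(j & Hj & H)|H]; [exists j|exists (S n)]; auto.
    * intros (j & Hj & H). destruct (Nat.eq_dec j (S n)) as [->|Hne]; auto.
      left; exists j; split; auto; lia.
Qed.

(** A bounded component of the complement of [F], when [F] is closed. *)
Definition gap (F : R -> Prop) (u v : R) : Prop :=
  F u /\ F v /\ u < v /\ forall y, u < y < v -> ~ F y.

Lemma closest_below (F : R -> Prop) (x : R) :
  closed_nowhere_dense F -> ~ F x -> (exists y, F y /\ y < x) ->
  exists u, F u /\ u < x /\ forall y, u < y <= x -> ~ F y.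
Proof.
intros [HF _] Hx (y0 & Fy0 & Hy0).
destruct (completeness (fun y => F y /\ y < x)) as [s [Hub Hlub]].
- exists x; intros y [_ Hy]; lra.
- exists y0; auto.
- assert (Hsx : s <= x) by (apply Hlub; intros y [_ Hy]; lra).
  assert (Fs : F s).
  { apply NNPP; intros Hs. destruct (HF s Hs) as (c & d & Hcd & Hd).
    assert (s <= c); [|lra]. apply Hlub. intros y [Fy Hy].
    apply Rnot_lt_le; intros Hc. apply (Hd y); auto.
    assert (y <= s) by (apply Hub; auto). lra. }
  exists s; split; auto. split.
  + destruct Hsx as [|E]; auto. now rewrite E in Fs.
  + intros y Hy Fy. destruct (proj2 Hy) as [Hlt| ->]; auto.
    assert (y <= s) by (apply Hub; auto). lra.
Qed.

Lemma gap_exists (F : R -> Prop) (x : R) :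
  closed_nowhere_dense F -> ~ F x -> (exists y, F y /\ y < x) -> (exists y, F y /\ x < y) ->
  exists u v, gap F u v /\ u < x < v.
Proof.
intros HF Hx Hl (y & Fy & Hy).
destruct (closest_below F x) as (u & Fu & Hu & Hu'); auto.
(* The right end of the gap is found by reflection. *)
destruct (closest_below (fun t => F (- t)) (- x)) as (v & Fv & Hv & Hv').
- destruct HF as [H1 H2]. split.
  + intros t Ht. destruct (H1 (- t) Ht) as (c & d & Hcd & Hd).
    exists (- d), (- c); split; [lra|]. intros z Hz; apply Hd; lra.
  + intros p q Hpq. destruct (H2 (- q) (- p)) as (t & Ft & Ht); [lra|].
    exists (- t); rewrite Ropp_involutive; split; auto; lra.
- now rewrite Ropp_involutive.
- exists (- y); rewrite Ropp_involutive; split; auto; lra.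
- exists u, (- v); split; [|lra]. repeat split; auto; try lra.
  intros t Ht. destruct (Rle_or_lt t x) as [Hle|Hlt].
  + apply Hu'; lra.
  + rewrite <- (Ropp_involutive t). apply Hv'; lra.
Qed.

Lemma gap_unique (F : R -> Prop) (u v u' v' x : R) :
  gap F u v -> gap F u' v' -> u < x < v -> u' < x < v' -> u = u' /\ v = v'.
Proof.
intros (Fu & Fv & _ & H) (Fu' & Fv' & _ & H') Hx Hx'. split.
- destruct (Rtotal_order u u') as [Hl|[E|Hl]]; auto; exfalso.
  + apply (H u'); auto; lra.
  + apply (H' u); auto; lra.
- destruct (Rtotal_order v v') as [Hl|[E|Hl]]; auto; exfalso.
  + apply (H' v); auto; lra.
  + apply (H v'); auto; lra.
Qed.

Lemma gap_in_segment (F : R -> Prop) (u v a b x : R) :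
  gap F u v -> F a -> F b -> u < x < v -> a < x < b -> a <= u /\ v <= b.
Proof.
intros (Fu & Fv & _ & H) Fa Fb Hx Hab.
split; apply Rnot_lt_le; intros Hlt; [apply (H a)|apply (H b)]; auto; lra.
Qed.

Lemma glue_on_gaps (F : R -> Prop) (f : R -> R) (V : R -> R -> R -> Prop) :
  (forall u v, gap F u v -> exists g, oscillates u v (V u v) g) ->
  (forall x, ~ F x -> exists u v, gap F u v /\ u < x < v) ->
  exists g, (forall x, F x -> g x = f x) /\ forall u v, gap F u v -> oscillates u v (V u v) g.
Proof.
intros Hosc Hgap.
pose (G := fun u v => epsilon (inhabits f) (fun g => oscillates u v (V u v) g)).
assert (HG : forall u v, gap F u v -> oscillates u v (V u v) (G u v)).
{ intros u v Huv. apply epsilon_spec; auto. }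
pose (val := fun x y => (F x /\ y = f x) \/ exists u v, gap F u v /\ u < x < v /\ y = G u v x).
assert (Hval : forall x, exists y, val x y).
{ intros x. destruct (classic (F x)) as [Fx|Fx].
  - exists (f x); left; auto.
  - destruct (Hgap x Fx) as (u & v & Huv & Hx). exists (G u v x); right; eauto. }
pose (g := fun x => proj1_sig (constructive_indefinite_description _ (Hval x))).
assert (Hg : forall x, val x (g x)).
{ intros x; unfold g; destruct (constructive_indefinite_description _ (Hval x)); auto. }
exists g; split.
- intros x Fx. destruct (Hg x) as [[_ E]|(u & v & (_ & _ & _ & H) & Hx & _)]; auto.
  exfalso; exact (H x Hx Fx).
- intros u v Huv.
  assert (Heq : forall x, u < x < v -> g x = G u v x).
  { intros x Hx. destruct (Hg x) as [[Fx _]|(u' & v' & Huv' & Hx' & E)].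
    - exfalso. exact (proj2 (proj2 (proj2 Huv)) x Hx Fx).
    - destruct (gap_unique F u v u' v' x) as [<- <-]; auto. }
  destruct (HG u v Huv) as (H1 & H2 & H3). repeat split.
  + intros x Hx. apply (continuity_pt_eq_on g (G u v) u v); auto.
  + intros x Hx. rewrite Heq; auto.
  + destruct (H3 y x H H0) as [(z & Hz & E) _]. exists z; rewrite Heq; auto; lra.
  + destruct (H3 y x H H0) as [_ (z & Hz & E)]. exists z; rewrite Heq; auto; lra.
Qed.

(** * The approximating sequence *)

(** If exactly one of the two points lies in [F], or they lie in different gaps, a gap containing
    one of them has an end between them, near which all values of [V u v] are taken, among them one
    strictly between the two given values. Two points of one gap are settled by the intermediate
    value theorem, two points of [F] by the last hypothesis. *)
Lemma swiatkowski_of_oscillation tau (F : R -> Prop) (V : R -> R -> R -> Prop) (g : R -> R) :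
  (forall U, open_set U -> tau U) ->
  (forall x, ~ F x -> exists u v, gap F u v /\ u < x < v) ->
  (forall u v, gap F u v -> oscillates u v (V u v) g) ->
  (forall u v y L, gap F u v -> V u v y -> y <> L -> exists y', V u v y' /\ in_I y L y') ->
  (forall a b, a < b -> F a -> F b -> g a <> g b ->
     exists u v y, gap F u v /\ a <= u /\ v <= b /\ V u v y /\ in_I (g a) (g b) y) ->
  swiatkowski tau g.
Proof.
intros Ho Hgap Hosc HV HF.
assert (H : forall a b, a < b -> g a <> g b ->
  exists x, continuity_pt g x /\ a < x < b /\ in_I (g a) (g b) (g x)).
{ intros a b Hab Hne.
  destruct (classic (F a)) as [Fa|Fa]; [destruct (classic (F b)) as [Fb|Fb]|].
  - destruct (HF a b) as (u & v & y & Huv & Hu & Hv & Vy & Hy); auto.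
    assert (Hlt : u < v) by apply Huv.
    destruct (Hosc u v Huv) as (Hc & _ & Hhit).
    destruct (Hhit y ((u + v) / 2)) as [(x & Hx & <-) _]; auto; [lra|].
    exists x; repeat split; try apply Hc; try apply Hy; lra.
  - destruct (Hgap b Fb) as (u & v & Huv & Hb).
    destruct (Hosc u v Huv) as (Hc & Hin & Hhit).
    destruct (HV u v (g b) (g a)) as (y & Vy & Hy); auto.
    destruct (Hhit y b) as [(x & Hx & <-) _]; auto.
    assert (a <= u).
    { apply Rnot_lt_le; intros Hlt. apply (proj2 (proj2 (proj2 Huv)) a); auto; lra. }
    exists x; split; [apply Hc; lra|split; [lra|]]. now apply in_I_comm.
  - destruct (Hgap a Fa) as (u & v & Huv & Ha).
    destruct (Hosc u v Huv) as (Hc & Hin & Hhit).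
    destruct (Rlt_or_le b v) as [Hbv|Hbv].
    + destruct (intermediate_value g a b ((g a + g b) / 2)) as (x & Hx & E).
      * intros t. rewrite Rmin_left, Rmax_right by lra. intros Ht; apply Hc; lra.
      * apply in_I_cases; lra.
      * apply in_I_cases in Hx. exists x; rewrite E; split; [apply Hc; lra|].
        split; [lra|]. apply in_I_cases; lra.
    + destruct (HV u v (g a) (g b)) as (y & Vy & Hy); auto.
      destruct (Hhit y a) as [_ (x & Hx & <-)]; auto.
      exists x; split; [apply Hc; lra|split; auto; lra]. }
intros a b Hab.
assert (Hw : exists x, continuity_pt g x /\ in_I a b x /\ in_I (g a) (g b) (g x)).
{ destruct (Rtotal_order a b) as [Hl|[->|Hl]]; [|lra|].
  - destruct (H a b Hl) as (x & Hc & Hx & Hg); [lra|]. exists x; rewrite (in_I_cases a b); auto.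
  - destruct (H b a Hl) as (x & Hc & Hx & Hg); [lra|]. exists x; rewrite (in_I_cases a b).
    rewrite in_I_comm in Hg; auto. }
destruct Hw as (x & Hc & Hx & Hg). exists x.
split; [now apply cont_tau_of_continuity_pt|split; auto].
apply in_I_cases in Hg; lra.
Qed.

Lemma maximal_index (P : nat -> Prop) (n : nat) :
  exists k, (k <= n)%nat /\ (k = 0%nat \/ P k) /\
    forall k', (1 <= k' <= n)%nat -> P k' -> (k' <= k)%nat.
Proof.
induction n as [|n (k & Hk & HPk & Hmax)].
- exists 0%nat; repeat split; auto; lia.
- destruct (classic (P (S n))) as [HP|HP].
  + exists (S n); repeat split; auto; lia.
  + exists k; repeat split; auto. intros k' Hk' HPk'.
    destruct (Nat.eq_dec k' (S n)) as [->|]; [tauto|]. apply Hmax; auto; lia.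
Qed.

(** * Levels and targets of gaps *)

Definition rate (n : nat) : R := / (INR n + 1).

Lemma rate_le (m n : nat) : (m <= n)%nat -> rate n <= rate m.
Proof.
intros H. unfold rate. apply Rinv_le_contravar.
- pose proof (pos_INR m); lra.
- apply le_INR in H; lra.
Qed.

(** These sets go into the [F n], so that a point outside all [F n] has tame neighbourhoods of every
    precision. *)
Lemma tame_complement_closed_nowhere_dense (f : R -> R) (B : R -> Prop) (eps : R) :
  frakS f -> residual B -> continuous_on f B -> eps > 0 ->
  closed_nowhere_dense (fun x => ~ exists c d, c < x < d /\ tame f B c d eps).
Proof.
intros Hf HB Hc He. split.
- intros x Hx. apply NNPP in Hx as (c & d & Hx & HT). exists c, d; split; auto.
  intros y Hy Hn; apply Hn; eauto.
- intros p q Hpq. destruct (tame_dense f B eps p q) as (c & d & H1 & H2 & H3 & HT); auto.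
  exists ((c + d) / 2); split; [|lra].
  intros Hn; apply Hn. exists c, d; split; auto; lra.
Qed.

(* [level n c d] is the best precision, among the first [n], at which (c, d) is tame; level 0
   means none, and then [target] is the whole line.  The interval is enlarged by [rate n]
   so that the levels of nearby gaps can be compared. *)
Definition level_spec (f : R -> R) (B : R -> Prop) (n : nat) (c d : R) (k : nat) : Prop :=
  (k <= n)%nat /\ (k = 0%nat \/ tame f B c d (rate k)) /\
  forall k', (1 <= k' <= n)%nat -> tame f B c d (rate k') -> (k' <= k)%nat.

Definition level f B n c d : nat := epsilon (inhabits 0%nat) (level_spec f B n c d).

Lemma levelP f B n c d : level_spec f B n c d (level f B n c d).
Proof.
unfold level. apply epsilon_spec. apply (maximal_index (fun k => tame f B c d (rate k))).
Qed.

Definition sample (B : R -> Prop) (u v : R) : R :=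
  epsilon (inhabits 0) (fun x => B x /\ u < x < v).

Lemma sampleP (B : R -> Prop) (u v : R) :
  meets_intervals B -> u < v -> B (sample B u v) /\ u < sample B u v < v.
Proof. intros HB Huv. apply (epsilon_spec (inhabits 0) (fun x => B x /\ u < x < v)), HB, Huv. Qed.

(** At level k, [f] on [B] in (u, v) is within [rate k] of its sampled value, so the doubled radius
    makes the target contain all points closer than [rate k] to such a value. *)
Definition target (f : R -> R) (B : R -> Prop) (n : nat) (u v y : R) : Prop :=
  let k := level f B n (u - rate n) (v + rate n) in
  k = 0%nat \/ Rabs (y - f (sample B u v)) < 2 * rate k.

Lemma target_oscillates f B n u v : exists g, oscillates u v (target f B n u v) g.
Proof.
unfold target. set (k := level f B n (u - rate n) (v + rate n)).
destruct (Nat.eq_dec k 0) as [E|E].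
- exists (wild u v). apply wild_oscillates; auto.
- eexists. apply (atan_wild_oscillates u v (f (sample B u v)) (2 * rate k)).
  + pose proof (inv_succ_pos k). unfold rate; lra.
  + intros y; split; auto. intros [H|H]; [tauto|auto].
Qed.

Lemma target_open f B n u v y L :
  target f B n u v y -> y <> L -> exists y', target f B n u v y' /\ in_I y L y'.
Proof.
unfold target. set (k := level f B n (u - rate n) (v + rate n)).
set (s := f (sample B u v)).
intros [H|H] Hne.
- exists ((y + L) / 2); split; auto. apply in_I_cases. lra.
- set (e := 2 * rate k) in *. apply Rabs_def2 in H.
  destruct (Rtotal_order y L) as [Hl|[->|Hl]]; [|lra|].
  + set (m := Rmin L (s + e)).
    assert (y < m) by (apply Rmin_glb_lt; lra).
    pose proof (Rmin_l L (s + e) : m <= L). pose proof (Rmin_r L (s + e) : m <= s + e).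
    exists ((y + m) / 2); split; [right; apply Rabs_def1; lra|apply in_I_cases; lra].
  + set (m := Rmax L (s - e)).
    assert (m < y) by (apply Rmax_lub_lt; lra).
    pose proof (Rmax_l L (s - e) : L <= m). pose proof (Rmax_r L (s - e) : s - e <= m).
    exists ((y + m) / 2); split; [right; apply Rabs_def1; lra|apply in_I_cases; lra].
Qed.

Lemma interval_in_band (lo hi y e : R) :
  lo < hi -> e > 0 -> lo - e < y < hi + e -> exists z, lo < z < hi /\ Rabs (z - y) < e.
Proof.
intros Hlh He Hy. set (l := Rmax lo (y - e)). set (r := Rmin hi (y + e)).
assert (l < r) by (apply Rmax_lub_lt; apply Rmin_glb_lt; lra).
pose proof (Rmax_l lo (y - e) : lo <= l). pose proof (Rmax_r lo (y - e) : y - e <= l).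
pose proof (Rmin_l hi (y + e) : r <= hi). pose proof (Rmin_r hi (y + e) : r <= y + e).
exists ((l + r) / 2); split; [lra|apply Rabs_def1; lra].
Qed.

(** If the targets of all gaps in [a, b] missed the values strictly between [f a] and [f b], then
    [f] on [B] would avoid an enlargement of that range, which [tame_chain] refutes. *)
Lemma gap_target_separates (f : R -> R) (B F : R -> Prop) (n : nat) (a b : R) :
  residual B -> continuous_on f B -> closed_nowhere_dense F ->
  (forall x, ~ F x -> exists u v, gap F u v /\ u < x < v) ->
  a < b -> F a -> F b -> f a <> f b ->
  exists u v y, gap F u v /\ a <= u /\ v <= b /\ target f B n u v y /\ in_I (f a) (f b) y.
Proof.
intros HB Hc HF Hgap Hab Fa Fb Hne. apply NNPP; intros Hn.
set (lo := Rmin (f a) (f b)). set (hi := Rmax (f a) (f b)).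
assert (Hlohi : lo < hi).
{ unfold lo, hi, Rmin, Rmax. destruct (Rle_dec (f a) (f b)); lra. }
assert (HBd : meets_intervals B) by now apply residual_meets_intervals.
assert (HBF : meets_intervals (fun x => B x /\ ~ F x)).
{ apply residual_meets_intervals, residual_and; auto.
  apply (meager_sub _ F); [intros x; apply NNPP|]. now apply closed_nowhere_dense_meager. }
pose proof (inv_succ_pos n : 0 < rate n) as Hr.
assert (Hpt : forall c d x, d - c <= rate n -> B x -> ~ F x -> c < x < d -> a < x < b ->
  let k := level f B n c d in
  (1 <= k)%nat /\ tame f B c d (rate k) /\ (hi + rate k <= f x \/ f x <= lo - rate k)).
{ intros c d x Hcd Bx Fx Hx Hxab k.
  destruct (Hgap x Fx) as (u & v & Huv & Hxuv).
  destruct (gap_in_segment F u v a b x) as [Hu Hv]; auto.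
  assert (Hnot : forall y, lo < y < hi -> ~ target f B n u v y).
  { intros y Hy Ht. apply Hn. exists u, v, y; auto. }
  unfold target in Hnot. set (k' := level f B n (u - rate n) (v + rate n)) in Hnot.
  destruct (levelP f B n (u - rate n) (v + rate n)) as (Hk'n & HT' & _). fold k' in Hk'n, HT'.
  (* At level 0 the target is the whole line and cannot miss (lo, hi). *)
  destruct (Nat.eq_dec k' 0) as [E|E]; [exfalso; apply (Hnot ((lo + hi) / 2)); auto; lra|].
  destruct HT' as [|HT']; [tauto|].
  destruct (levelP f B n c d) as (Hkn & HT & Hmax). fold k in Hkn, HT, Hmax.
  (* An interval around [x] no longer than [rate n] lies in the enlarged gap, so its level is at
     least as high. *)
  assert (Hkk : (k' <= k)%nat).
  { apply Hmax; [lia|]. apply (tame_sub f B (u - rate n) (v + rate n)); auto; lra. }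
  destruct HT as [|HT]; [lia|]. split; [lia|split; [exact HT|]].
  apply rate_le in Hkk. pose proof (inv_succ_pos k' : 0 < rate k') as Hrk'.
  destruct (Rle_or_lt (hi + rate k) (f x)) as [|H1]; auto.
  destruct (Rle_or_lt (f x) (lo - rate k)) as [|H2]; auto. exfalso.
  destruct (interval_in_band lo hi (f x) (rate k')) as (z & Hz & Hzx); auto; [lra|].
  apply (Hnot z Hz). right.
  destruct (sampleP B u v HBd) as [Bs Hs]; [apply Huv|].
  destruct HT' as (_ & HO & _).
  specialize (HO x (sample B u v) Bx Bs ltac:(lra) ltac:(lra)).
  replace (z - f (sample B u v)) with (z - f x + (f x - f (sample B u v))) by ring.
  pose proof (Rabs_triang (z - f x) (f x - f (sample B u v))). lra. }
apply (tame_chain f B a b lo hi); auto.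
- unfold lo, hi; split; [apply Rmin_l|apply Rmax_l].
- unfold lo, hi; split; [apply Rmin_r|apply Rmax_r].
- intros t Ht. set (c := t - rate n / 2). set (d := t + rate n / 2).
  assert (Hcd : c < t < d) by (unfold c, d; lra).
  assert (Hlen : d - c <= rate n) by (unfold c, d; lra).
  exists c, d, (rate (level f B n c d)). split; auto.
  (* One point of [B] off [F] suffices to show that (c, d) has positive level. *)
  destruct (sub_interval a b c d t) as (l & r & Hlr & H1 & H2 & H3 & H4 & _); auto.
  destruct (HBF l r Hlr) as (x0 & [Bx0 Fx0] & Hx0).
  destruct (Hpt c d x0) as (Hk & HT & _); auto; try lra.
  set (k := level f B n c d) in *.
  pose proof (inv_succ_pos k : 0 < rate k) as Hrk.
  split; auto. split; auto. intros x Bx Hx Hxab.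
  destruct (Rle_or_lt (hi + rate k) (f x)) as [|Hh]; auto.
  destruct (Rle_or_lt (f x) (lo - rate k)) as [|Hl]; auto. exfalso.
  (* Here [x] may lie in [F]; by relative continuity a nearby point [y] of [B] off [F] would violate
     the same inequalities. *)
  destruct (Hc x Bx (Rmin (hi + rate k - f x) (f x - (lo - rate k)))) as (p & q & Hpq & Hosc).
  { apply Rmin_pos; lra. }
  pose proof (Rmin_l (hi + rate k - f x) (f x - (lo - rate k))).
  pose proof (Rmin_r (hi + rate k - f x) (f x - (lo - rate k))).
  destruct (sub_interval a b (Rmax c p) (Rmin d q) x) as (l2 & r2 & Hlr2 & ? & ? & ? & ? & _);
    [lra|lra|split; [apply Rmax_lub_lt|apply Rmin_glb_lt]; lra|].
  pose proof (Rmax_l c p). pose proof (Rmax_r c p).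
  pose proof (Rmin_l d q). pose proof (Rmin_r d q).
  destruct (HBF l2 r2 Hlr2) as (y & [By Fy] & Hy).
  specialize (Hosc y ltac:(lra) By). apply Rabs_def2 in Hosc.
  destruct (Hpt c d y Hlen By Fy) as (_ & _ & Hy1); try lra.
  fold k in Hy1. lra.
Qed.

Lemma frakS_lim_swiat tau (f : R -> R) :
  (forall U, open_set U -> tau U) -> frakS f -> lim_swiat tau f.
Proof.
intros Ho Hf.
destruct (baire_fun_continuous_on_residual f (proj1 Hf)) as (B & HB & Hc).
assert (HBd : meets_intervals B) by now apply residual_meets_intervals.
destruct HB as (N & HN & HBN).
assert (HB : residual B) by (exists N; auto).
pose (H := fun j x => ~ exists c d, c < x < d /\ tame f B c d (rate j)).
(* Outside all these sets a point lies in [B], by the closures of the [N j], and has tame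
   neighbourhoods of every precision, by the [H j]; the grids bound and shorten the gaps. *)
destruct (increasing_closed_cover (fun j x => (adherence (N j) x \/ H j x) \/ grid j x))
  as (F & HF & HFC).
{ intros j. repeat apply closed_nowhere_dense_or.
  - now apply adherence_closed_nowhere_dense.
  - apply tame_complement_closed_nowhere_dense; auto. apply inv_succ_pos.
  - apply grid_closed_nowhere_dense. }
assert (Hmono : forall m n x, (m <= n)%nat -> F m x -> F n x).
{ intros m n x Hmn. rewrite !HFC. intros (j & Hj & Hx). exists j; split; auto; lia. }
assert (Hgap : forall n x, ~ F n x -> exists u v, gap (F n) u v /\ u < x < v).
{ intros n x Hx. destruct (grid_unbounded x) as [(y & Gy & Hy) (z & Gz & Hz)].
  apply gap_exists; auto; [exists y|exists z]; split; auto; apply HFC; exists 0%nat;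
  (split; [lia|now right]). }
assert (Hg : forall n, exists g, (forall x, F n x -> g x = f x) /\
  forall u v, gap (F n) u v -> oscillates u v (target f B n u v) g).
{ intros n. apply glue_on_gaps; auto. intros u v _. apply target_oscillates. }
pose (g := fun n => proj1_sig (constructive_indefinite_description _ (Hg n))).
assert (HgP : forall n, (forall x, F n x -> g n x = f x) /\
  forall u v, gap (F n) u v -> oscillates u v (target f B n u v) (g n)).
{ intros n; unfold g; destruct (constructive_indefinite_description _ (Hg n)); auto. }
exists g; split.
- intros n. destruct (HgP n) as [Hgf Hgo].
  apply (swiatkowski_of_oscillation tau (F n) (target f B n)); auto.
  + intros u v y L _; apply target_open.
  + intros a b Hab Fa Fb. rewrite !Hgf by auto. intros Hne.
    apply (gap_target_separates f B); auto.
- intros x. destruct (classic (exists m, F m x)) as [[m Fx]|Hx].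
  + intros eps He. exists m; intros n Hn. rewrite (proj1 (HgP n)) by (apply (Hmono m); auto).
    unfold Rdist; rewrite Rminus_diag, Rabs_R0; auto.
  + assert (HxF : forall n, ~ F n x) by eauto.
    assert (Bx : B x).
    { apply NNPP; intros Hb. destruct (HBN x Hb) as [j Hj]. apply (HxF j), HFC.
      exists j; split; auto. left; left; now apply adherence_P1. }
    intros eps He.
    (* Two thirds of [eps] go to the radius of the target, one third to the oscillation of [f] on
       [B]. *)
    destruct (inv_succ_small (eps / 3)) as [k Hk]; [lra|].
    (* The successor is taken because [level_spec] counts precisions from 1 on. *)
    specialize (Hk (S k) ltac:(lia)). change (/ (INR (S k) + 1)) with (rate (S k)) in Hk.
    assert (HT : exists c d, c < x < d /\ tame f B c d (rate (S k))).
    { apply NNPP; intros Hn. apply (HxF (S k)), HFC. exists (S k); split; auto. }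
    destruct HT as (c & d & Hcd & HT).
    (* Grid points in the inner halves confine the gap; the outer halves leave room for its
       enlargement by [rate n]. *)
    destruct (grid_dense ((c + x) / 2) x) as (j1 & y1 & Gy1 & Hy1); [lra|].
    destruct (grid_dense x ((x + d) / 2)) as (j2 & y2 & Gy2 & Hy2); [lra|].
    destruct (inv_succ_small (Rmin ((x - c) / 2) ((d - x) / 2))) as [m Hm];
      [apply Rmin_pos; lra|].
    exists (S k + j1 + j2 + m)%nat. intros n Hn.
    assert (Fy1 : F n y1) by (apply HFC; exists j1; split; [lia|right; auto]).
    assert (Fy2 : F n y2) by (apply HFC; exists j2; split; [lia|right; auto]).
    specialize (Hm n ltac:(lia)). change (/ (INR n + 1)) with (rate n) in Hm.
    pose proof (Rmin_l ((x - c) / 2) ((d - x) / 2)). pose proof (Rmin_r ((x - c) / 2) ((d - x) / 2)).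
    destruct (Hgap n x (HxF n)) as (u & v & Huv & Hxuv).
    destruct (gap_in_segment (F n) u v y1 y2 x) as [Hu Hv]; auto; [lra|].
    destruct (proj2 (HgP n) u v Huv) as (_ & Hin & _). specialize (Hin x Hxuv).
    assert (HT' : tame f B (u - rate n) (v + rate n) (rate (S k)))
      by (apply (tame_sub f B c d); auto; lra).
    unfold target in Hin.
    destruct (levelP f B n (u - rate n) (v + rate n)) as (_ & _ & Hmax).
    specialize (Hmax (S k) ltac:(lia) HT').
    set (l := level f B n (u - rate n) (v + rate n)) in *.
    destruct Hin as [E|Hin]; [lia|].
    apply rate_le in Hmax.
    destruct (sampleP B u v HBd) as [Bs Hs]; [lra|].
    destruct HT' as (_ & HO & _).
    specialize (HO (sample B u v) x Bs Bx ltac:(lra) ltac:(lra)).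
    unfold Rdist.
    replace (g n x - f x) with (g n x - f (sample B u v) + (f (sample B u v) - f x)) by ring.
    pose proof (Rabs_triang (g n x - f (sample B u v)) (f (sample B u v) - f x)). lra.
Qed.

Theorem mainTheorem11 (tau : (R -> Prop) -> Prop) :
  is_topology tau ->
  (forall U, open_set U -> tau U) ->
  (forall U, tau U -> (exists x, U x) -> baire_set U /\ ~ meager U) ->
  forall f : R -> R, lim_swiat tau f <-> frakS f.
Proof.
intros H1 H2 H3 f; split.
- apply lim_swiat_frakS. repeat split; try apply H1; auto; apply H3; auto.
- now apply frakS_lim_swiat.
Qed.
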